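(* Let $G$ be a non-elementary word-hyperbolic group. Suppose that $G$ has the engulfing property for all finitely generated subgroups $K\le G$ such that $\Lambda(K)$ is a proper subset of $\partial G$; that is, every such $K$ is engulfed in $G$. Then every quasi-convex subgroup $H\le G$ is almost separable in $G$, i.e. $H$ has finite index in its closure $\overline{H}$ in the profinite topology on $G$.
   Context: A finitely generated group $G$ is word-hyperbolic if, with the word metric of a finite generating set, it is a $\delta$-hyperbolic space for some $\delta\ge 0$. It is elementary if it is finite or contains a finite index infinite cyclic subgroup, and non-elementary otherwise. Its boundary at infinity $\partial G$ is the (metrisable, compact) space of equivalence classes of rays converging to infinity in the group. For a subgroup $H\le G$, the limit set $\Lambda(H)\subseteq\partial G$ is the set of points of $\partial G$ that are limits of sequences of elements of $H$ (empty if $H$ is finite). A subgroup $H\le G$ is engulfed if $H$ is contained in a proper finite index subgroup of $G$. A subgroup $H$ is quasi-convex if there is a constant $C$ such that every geodesic in the Cayley graph of $G$ joining two elements of $H$ lies in the $C$-neighbourhood of $H$. The profinite topology on $G$ has as a basis for the closed sets the cosets of all finite index normal subgroups of $G$; the closure $\overline{H}$ of a subgroup $H$ is the intersection of all finite index subgroups of $G$ containing $H$. *)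

(* Defs.v *)
From mathcomp Require Import all_boot all_order all_algebra.
From mathcomp Require Import boolp classical_sets functions cardinality.

Set Implicit Arguments.
Unset Strict Implicit.
Unset Printing Implicit Defensive.

Import Order.TTheory GRing.Theory Num.Theory.

Local Open Scope classical_set_scope.
Local Open Scope group_scope.

(* Groups are possibly infinite, so subgroups are Prop-valued sets, rather than
   the finite sets of fingroup. *)

Section Subgroups.
Variable G : groupType.
Implicit Types H K L S : set G.

Definition subgroup H : Prop := H 1 /\ forall x y, H x -> H y -> H (x / y).

Definition generated S : set G := smallest subgroup S.

Definition finitely_generated K : Prop :=
  exists2 S, finite_set S & K = generated S.

Definition lcosets H K : set (set G) := [set [set x * h | h in H] | x in K].

Definition finite_index H K : Prop := H `<=` K /\ finite_set (lcosets H K).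

Definition engulfed H : Prop :=
  exists L, [/\ subgroup L, L `<` [set: G], finite_index L [set: G] & H `<=` L].

(* The closure of the subgroup H in the profinite topology. *)
Definition profinite_closure H : set G :=
  \bigcap_(L in [set L | [/\ subgroup L, finite_index L [set: G] & H `<=` L]]) L.

Definition almost_separable H : Prop := finite_index H (profinite_closure H).

End Subgroups.

Definition elementary (G : groupType) : Prop :=
  finite_set [set: G] \/
  exists z : G, infinite_set (generated [set z]) /\
                finite_index (generated [set z]) [set: G].

(* Word metric geometry with respect to a set S of generators. *)

Section WordMetric.
Variables (G : groupType) (S : set G).
Implicit Types (x y z w g : G) (H : set G) (p r s u : nat -> G).

Definition word (l : seq G) : Prop := forall x, x \in l -> S x \/ S x^-1.

Definition has_word_of_size g (n : nat) : Prop :=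
  exists l : seq G, [/\ word l, size l = n & \prod_(x <- l) x = g].

(* Equal to 0, by default, on elements outside the subgroup generated by S. *)
Definition word_length g : nat :=
  xget 0%N [set n | has_word_of_size g n /\
                    forall m, has_word_of_size g m -> (n <= m)%N].

Definition word_dist x y : nat := word_length (x^-1 * y).

Definition gromov_product w x y : rat :=
  (((word_dist x w)%:R + (word_dist y w)%:R - (word_dist x y)%:R) / 2)%R.

(* Gromov's four-point condition; taking delta rational rather than real is no
   restriction, since delta may be increased. *)
Definition hyperbolic : Prop :=
  exists2 delta : rat, (0 <= delta)%R &
    forall w x y z,
      (Num.min (gromov_product w x y) (gromov_product w y z) - delta
         <= gromov_product w x z)%R.

(* Geodesics of the Cayley graph are given by their sequences of vertices. *)
Definition geodesic_segment (n : nat) p : Prop :=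
  forall i j, (i <= j)%N -> (j <= n)%N -> word_dist (p i) (p j) = (j - i)%N.

Definition geodesic_ray r : Prop :=
  forall i j, (i <= j)%N -> word_dist (r i) (r j) = (j - i)%N.

Definition asymptotic r s : Prop :=
  exists C : nat, forall i, (word_dist (r i) (s i) <= C)%N.

Definition ray_class r : set (nat -> G) :=
  [set s | geodesic_ray s /\ asymptotic r s].

Definition boundary : set (set (nat -> G)) :=
  [set ray_class r | r in geodesic_ray].

(* Convergence of the sequence u of group elements to the boundary point xi in
   the compactification of G by its boundary. *)
Definition converges_to_boundary u (xi : set (nat -> G)) : Prop :=
  forall r, xi r -> forall M : rat, exists N : nat,
    forall i j, (N <= i)%N -> (N <= j)%N -> (M <= gromov_product 1 (u i) (r j))%R.

Definition limit_set H : set (set (nat -> G)) :=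
  [set xi | boundary xi /\
            exists2 u, (forall i, H (u i)) & converges_to_boundary u xi].

Definition quasi_convex H : Prop :=
  exists C : nat, forall n p,
    geodesic_segment n p -> H (p 0%N) -> H (p n) ->
    forall i, (i <= n)%N -> exists2 h, H h & (word_dist (p i) h <= C)%N.

End WordMetric.

(* Main.v *)
Require Import Defs.
From mathcomp Require Import all_boot all_order all_algebra.
From mathcomp Require Import boolp classical_sets functions cardinality.
From mathcomp Require Import lra zify.

Set Implicit Arguments.
Unset Strict Implicit.
Unset Printing Implicit Defensive.

Import Order.TTheory GRing.Theory Num.Theory.

Local Open Scope classical_set_scope.
Local Open Scope group_scope.

(* Write cl H for the profinite closure of H and suppose that H has infinite index in
   cl H. For each generator s of G one finds k_s in C s C, where C = cl H' for a suitable
   finite index subgroup H' of H, such that H' and the k_s play ping-pong; the subgroup K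
   they generate then has a limit set missing the endpoint of some ray. By engulfing, K lies
   in a proper finite index subgroup L. As L contains H', it contains C, hence every s, so
   L = G, a contradiction.

   Ping-pong needs long elements of cl H pointing in boundedly many prescribed directions
   transverse to H, and an H' with no short elements outside a finite normal subgroup N of
   G. Take N = cl 1: then G is residually finite modulo N, which gives H', and N is finite
   by the same argument applied to H = 1, the directions being translates of a limit point
   of cl 1. For infinite H the directions are translates under H of a limit of elements x of
   cl H that are shortest in their cosets H x; finite H reduces to H = 1. *)

(** * Subgroups and the profinite topology *)

Section Subgroups.
Variable G : groupType.
Implicit Types (x y z g : G) (H K L : set G) (Y : seq G).

Definition grpE := (@invgM G, @invgK G, @invg1 G, @mulgA G, @mulg1 G,
  @mul1g G, @mulgV G, @mulVg G, @mulgK G, @mulgVK G).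

Lemma subgroup1 H : subgroup H -> H 1.
Proof. by case. Qed.

Lemma subgroupV H x : subgroup H -> H x -> H x^-1.
Proof. by move=> [H1 HV] Hx; rewrite -[x^-1]mul1g; apply: HV. Qed.

Lemma subgroupM H x y : subgroup H -> H x -> H y -> H (x * y).
Proof.
move=> sH Hx Hy; rewrite -[y]invgK; apply: (sH.2) => //.
exact: subgroupV.
Qed.

Lemma subgroupX H x n : subgroup H -> H x -> H (x ^+ n).
Proof.
move=> sH Hx; elim: n => [|n IH]; first exact: subgroup1.
by rewrite expgS; apply: subgroupM.
Qed.

Lemma subgroupI H K : subgroup H -> subgroup K -> subgroup (H `&` K).
Proof.
move=> sH sK; split; first by split; apply: subgroup1.
by move=> x y [Hx Kx] [Hy Ky]; split; [apply: sH.2 | apply: sK.2].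
Qed.

Lemma subgroup_generated S : subgroup (generated S : set G).
Proof.
split=> [K [[]] //|x y gx gy K [sK SK]].
by apply: sK.2; [apply: gx | apply: gy].
Qed.

Lemma sub_generated S : S `<=` (generated S : set G).
Proof. by move=> x Sx K [_]; apply. Qed.

Lemma generated_sub S K : subgroup K -> S `<=` K -> generated S `<=` K.
Proof. by move=> sK SK x; apply. Qed.

(** The working form of finite index: a list of left coset representatives. Neither L inside K nor Y
    inside K is required, so coverings compose, restrict and pass to closures. *)
Definition covers Y L K := forall x, K x -> exists2 y, y \in Y & L (y^-1 * x).

Lemma finite_index_covers L K : finite_index L K -> subgroup L ->
  exists2 Y, (forall y, y \in Y -> K y) & covers Y L K.
Proof.
move=> [LK fin] sL.
have /finite_seqP[s Es] := fin.
have img B : B \in s -> exists2 x, K x & [set x * h | h in L] = B.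
  by move=> Bs; have : [set` s] B by []; rewrite -Es.
pose rep B := xget 1 [set x | K x /\ [set x * h | h in L] = B].
have repP B : B \in s -> K (rep B) /\ [set rep B * h | h in L] = B.
  move=> /img[x Kx Ex]; rewrite /rep.
  by case: xgetP => [y -> [] //|/(_ x)]; case.
exists (map rep s) => [y /mapP[B /repP[KB _] ->] //|x Kx].
have xs : [set x * h | h in L] \in s.
  by have : lcosets L K [set x * h | h in L] by [exists x]; rewrite Es.
exists (rep [set x * h | h in L]); first exact: map_f.
have [_ E] := repP _ xs.
have [h Lh Eh] : [set rep [set x * h | h in L] * h | h in L] x.
  by rewrite E; exists 1; [exact: subgroup1 | rewrite mulg1].
by move: Eh; set r := rep _ => <-; rewrite mulKg.
Qed.

Lemma covers_finite_index Y L K : subgroup L -> L `<=` K -> covers Y L K ->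
  finite_index L K.
Proof.
move=> sL LK cov; split=> //.
apply: (@sub_finite_set _ _ [set [set y * h | h in L] | y in [set` Y]]).
  move=> _ [x Kx <-]; have [y yY Lyx] := cov _ Kx.
  exists y => //; apply/seteqP; split=> _ [h Lh <-].
    exists ((y^-1 * x)^-1 * h); last by rewrite !grpE.
    by apply: subgroupM => //; apply: subgroupV.
  exists ((y^-1 * x) * h); last by rewrite !grpE.
  exact: subgroupM.
by apply: finite_image; apply: finite_seq.
Qed.

Lemma covers_trans Y Y' L L' K : covers Y L K -> covers Y' L' L ->
  covers [seq y * y' | y <- Y, y' <- Y'] L' K.
Proof.
move=> cov cov' x Kx; have [y yY /cov'[y' yY' L'x]] := cov _ Kx.
exists (y * y'); first exact: allpairs_f.
by rewrite invgM -mulgA.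
Qed.

(** Each coset of L that meets H is given a representative in H; on the others [rep] falls back to
    1. *)
Lemma covers_restrict Y L H K : subgroup L -> subgroup H -> H `<=` K ->
  covers Y L K ->
  exists2 Y', (forall y, y \in Y' -> H y) & covers Y' (H `&` L) H.
Proof.
move=> sL sH HK cov.
pose rep y := xget 1 [set z | H z /\ L (y^-1 * z)].
have Hrep y : H (rep y) by rewrite /rep; case: xgetP => [x _ [] //|_]; apply: subgroup1.
exists (map rep Y) => [_ /mapP[y _ ->] //|x Hx].
have [y yY Lx] := cov _ (HK _ Hx); exists (rep y); first exact: map_f.
split; first by apply: subgroupM => //; apply: subgroupV.
have Lr : L (y^-1 * rep y) by rewrite /rep; case: xgetP => [z -> [] //|/(_ x)]; case.
have -> : (rep y)^-1 * x = (y^-1 * rep y)^-1 * (y^-1 * x) by rewrite !grpE.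
by apply: subgroupM => //; apply: subgroupV.
Qed.

Lemma covers_inter Y Y' L L' : subgroup L -> subgroup L' ->
  covers Y L setT -> covers Y' L' setT -> exists Z, covers Z (L `&` L') setT.
Proof.
move=> sL sL' cov cov'.
have [Z _ covZ] := covers_restrict sL' sL (fun _ _ => I) cov'.
by eexists; apply: covers_trans cov covZ.
Qed.

Lemma covers_inter_seq (I : eqType) (F : I -> set G) (l : seq I) :
  (forall i, i \in l -> subgroup (F i) /\ exists Y, covers Y (F i) setT) ->
  let L := [set x | forall i, i \in l -> F i x] in
  subgroup L /\ exists Y, covers Y L setT.
Proof.
elim: l => [|i l IH] fF /=.
  split; first by split.
  by exists [:: 1] => x _; exists 1; rewrite ?mem_seq1.
have [|sL [Y cY]] := IH; first by move=> j jl; apply: fF; rewrite inE jl orbT.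
have [sF [Y' cY']] := fF i (mem_head _ _).
set L0 := [set x | forall i, i \in l -> F i x] in sL cY.
have -> : [set x | forall j, j \in i :: l -> F j x] = F i `&` L0.
  apply/seteqP; split=> x /=.
    by move=> Fx; split=> [|j jl]; apply: Fx; rewrite inE ?eqxx ?jl ?orbT.
  by move=> [Fi Lx] j; rewrite inE => /orP[/eqP ->//|/Lx].
by split; [apply: subgroupI | apply: covers_inter cY' cY].
Qed.

(** The conjugate of L by g depends only on the coset g L, so the intersection of all conjugates is
    an intersection over the finite list Y. *)
Lemma normal_core Y L : subgroup L -> covers Y L setT ->
  exists L0, [/\ subgroup L0, L0 `<=` L, (forall g x, L0 x -> L0 (g * x * g^-1))
             & exists Y', covers Y' L0 setT].
Proof.
move=> sL cov.
have [|sC [Z cZ]] := @covers_inter_seq G (fun y => [set x | L (y^-1 * x * y)]) Y.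
  move=> y _; split.
    split=> /=; first by rewrite !grpE; apply: subgroup1.
    move=> u v Lu Lv.
    have -> : y^-1 * (u / v) * y = (y^-1 * u * y) / (y^-1 * v * y) by rewrite !grpE.
    exact: sL.2.
  exists [seq y' * y^-1 | y' <- Y] => x _.
  have [y' yY' Ly] := cov (x * y) I.
  exists (y' * y^-1); first by apply/mapP; exists y'.
  by rewrite /= !grpE; move: Ly; rewrite !grpE.
set C := [set x | _] in sC cZ.
have CE x : C x -> forall g, L (g^-1 * x * g).
  move=> Cx g; have [y yY Ly] := cov g I.
  have -> : g^-1 * x * g = (y^-1 * g)^-1 * (y^-1 * x * y) * (y^-1 * g).
    by rewrite !grpE.
  apply: subgroupM => //; apply: subgroupM => //; first exact: subgroupV.
  exact: (Cx y yY).
exists C; split=> //; last by exists Z.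
  by move=> x /CE/(_ 1); rewrite !grpE.
move=> g x Cx y _ /=.
have -> : y^-1 * (g * x / g) * y = (g^-1 * y)^-1 * x * (g^-1 * y).
  by rewrite !grpE.
exact: CE.
Qed.

Definition cofinite L := subgroup L /\ exists Y, covers Y L setT.

Lemma cofiniteP L : subgroup L /\ finite_index L setT <-> cofinite L.
Proof.
split=> [[sL fi]|[sL [Y cY]]].
  by have [Y _ cY] := finite_index_covers fi sL; split=> //; exists Y.
by split=> //; apply: covers_finite_index cY.
Qed.

Lemma closureP H x :
  profinite_closure H x <-> forall L, cofinite L -> H `<=` L -> L x.
Proof.
split=> [cx L /cofiniteP[sL fi] HL|Lx L [sL fi HL]]; first exact: cx.
by apply: Lx => //; apply/cofiniteP.
Qed.

Lemma sub_closure H : H `<=` profinite_closure H.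
Proof. by move=> x Hx; apply/closureP => L _; apply. Qed.

Lemma subgroup_closure H : subgroup (profinite_closure H).
Proof.
split; first by apply/closureP => L [sL _] _; apply: subgroup1.
move=> x y /closureP cx /closureP cy; apply/closureP => L cL HL.
by apply: cL.1.2; [apply: cx | apply: cy].
Qed.

Lemma closure1_normal g x :
  profinite_closure [set 1 : G] x -> profinite_closure [set 1 : G] (g * x * g^-1).
Proof.
move=> /closureP cx; apply/closureP => L [sL [Y cY]] _.
have [L0 [sL0 L0L nL0 cL0]] := normal_core sL cY.
by apply: L0L; apply: nL0; apply: cx => // _ ->; apply: subgroup1.
Qed.

(** Take one subgroup per excluded point; the intersection of these finitely many subgroups is still
    cofinite. *)
Lemma cofinite_avoid H (l : seq G) :
  (forall x, x \in l -> ~ profinite_closure H x) ->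
  exists L, [/\ cofinite L, H `<=` L & forall x, x \in l -> ~ L x].
Proof.
move=> ncl.
have /choice[F FP] : forall x, exists L, x \in l -> [/\ cofinite L, H `<=` L & ~ L x].
  move=> x; have [/ncl/closureP/existsNP[L]|_] := boolP (x \in l); last by exists setT.
  by move=> /not_implyP[cL /not_implyP[HL nL]]; exists L.
have [|sL cL] := @covers_inter_seq G F l.
  by move=> x /FP[[]].
exists [set x | forall i, i \in l -> F i x]; split=> //.
  by move=> x Hx y /FP[_ + _]; apply.
by move=> x xl /= /(_ x xl); have [] := FP _ xl.
Qed.

(** Suppose that x in cl H lies outside Y cl H'. Some cofinite L containing H' avoids all y^-1 x.
    With L0 a normal cofinite subgroup inside L, the product H L0 is a cofinite subgroup containing
    H, hence x = h k; writing h in y H' puts y^-1 x in L. *)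
Lemma covers_closure Y H' H : subgroup H' -> subgroup H -> H' `<=` H ->
  covers Y H' H -> covers Y (profinite_closure H') (profinite_closure H).
Proof.
move=> sH' sH HH cov x cx; apply: contrapT => nx.
have [|L [cL HL nL]] := @cofinite_avoid H' [seq y^-1 * x | y <- Y].
  by move=> _ /mapP[y yY ->] cy; apply: nx; exists y.
have [sL [Z cZ]] := cL.
have [L0 [sL0 L0L nL0 [Z0 cZ0]]] := normal_core sL cZ.
pose M := [set h * k | h in H & k in L0].
have ME u : M u <-> exists h k, [/\ H h, L0 k & u = h * k].
  by split=> [[h Hh [k Lk <-]]|[h [k [Hh Lk ->]]]]; [exists h, k|exists h => //; exists k].
have : M x.
  move/closureP: cx; apply.
    split.
      split; first by apply/ME; exists 1, 1; rewrite mulg1; split=> //; apply: subgroup1.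
      move=> _ _ /ME[h [k [Hh Lk ->]]] /ME[h' [k' [Hh' Lk' ->]]]; apply/ME.
      exists (h / h'), (h' * (k / k') * h'^-1); split; last by rewrite !grpE.
        exact: sH.2.
      by apply: nL0; apply: sL0.2.
    exists Z0 => u _; have [y yZ Ly] := cZ0 u I; exists y => //.
    by apply/ME; exists 1, (y^-1 * u); rewrite mul1g; split=> //; apply: subgroup1.
  by move=> h Hh; apply/ME; exists h, 1; rewrite mulg1; split=> //; apply: subgroup1.
move=> /ME[h [k [Hh Lk Ex]]]; rewrite {x}Ex in cx nx nL.
have [y yY Hy] := cov _ Hh.
apply: (nL (y^-1 * (h * k))); first by apply/mapP; exists y.
by rewrite mulgA; apply: subgroupM => //; [apply: HL|apply: L0L].
Qed.

End Subgroups.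

(** * Word metric *)

Section WordMetricTheory.
Variables (G : groupType) (S : set G).
Hypotheses (finS : finite_set S) (genS : generated S = [set: G]).
Implicit Types (x y z g : G) (n m k : nat).

Local Notation wl := (word_length S).

Lemma has_word1 : has_word_of_size S 1 0.
Proof. by exists [::]; split=> //; rewrite big_nil. Qed.

Lemma has_wordM x y n m : has_word_of_size S x n -> has_word_of_size S y m ->
  has_word_of_size S (x * y) (n + m).
Proof.
move=> [l [wlx <- <-]] [l' [wly <- <-]]; exists (l ++ l'); split.
- by move=> z; rewrite mem_cat => /orP[/wlx|/wly].
- by rewrite size_cat.
- by rewrite big_cat.
Qed.

Lemma has_wordV x n : has_word_of_size S x n -> has_word_of_size S x^-1 n.
Proof.
move=> [l [wlx <- <-]]; exists (rev [seq z^-1 | z <- l]); split.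
- by move=> z; rewrite mem_rev => /mapP[y /wlx + ->]; rewrite invgK; tauto.
- by rewrite size_rev size_map.
- by rewrite -map_rev big_map prodgV revK.
Qed.

Lemma has_word_exists x : exists n, has_word_of_size S x n.
Proof.
have : generated S x by rewrite genS.
apply: (@generated_sub G S [set x | exists n, has_word_of_size S x n]).
  split; first by exists 0%N; exact: has_word1.
  by move=> y z [n yn] [m /has_wordV zm]; exists (n + m)%N; apply: has_wordM.
move=> y Sy; exists 1%N, [:: y]; split=> //; last by rewrite big_seq1.
by move=> z; rewrite mem_seq1 => /eqP ->; left.
Qed.

Lemma word_lengthP x : has_word_of_size S x (wl x) /\
  forall m, has_word_of_size S x m -> (wl x <= m)%N.
Proof.
rewrite /word_length; case: xgetP => [n _ //|] no; exfalso.
have ex : exists n, `[< has_word_of_size S x n >].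
  by have [n xn] := has_word_exists x; exists n; apply/asboolP.
case: (ex_minnP ex) => n /asboolP xn nmin; apply: (no n); split=> // m xm.
by apply: nmin; apply/asboolP.
Qed.

Lemma wl1 : wl 1 = 0%N.
Proof. by apply/eqP; rewrite -leqn0; apply: (word_lengthP 1).2; exact: has_word1. Qed.

Lemma wl0_eq x : wl x = 0%N -> x = 1.
Proof.
move=> x0; have [[l [_ + <-]] _] := word_lengthP x; rewrite x0.
by move/size0nil ->; rewrite big_nil.
Qed.

Lemma wlV x : wl x^-1 = wl x.
Proof.
have h y : (wl y^-1 <= wl y)%N.
  by apply: (word_lengthP _).2; apply: has_wordV; exact: (word_lengthP y).1.
by apply/eqP; rewrite eqn_leq h -{1}[x]invgK h.
Qed.

Lemma wlM x y : (wl (x * y) <= wl x + wl y)%N.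
Proof.
by apply: (word_lengthP _).2; apply: has_wordM; exact: (word_lengthP _).1.
Qed.

Lemma wl_split x k : (k <= wl x)%N ->
  exists2 y, wl y = k & wl (y^-1 * x) = (wl x - k)%N.
Proof.
move=> kx; have [[l [lS sl lx]] _] := word_lengthP x.
pose u := \prod_(z <- take k l) z; pose v := \prod_(z <- drop k l) z.
have uv : u * v = x by rewrite -big_cat cat_take_drop.
have uk : (wl u <= k)%N.
  apply: (word_lengthP _).2; exists (take k l); split=> //.
    by move=> z /mem_take/lS.
  by rewrite size_takel // sl.
have vk : (wl v <= wl x - k)%N.
  apply: (word_lengthP _).2; exists (drop k l); split=> //.
    by move=> z /mem_drop/lS.
  by rewrite size_drop sl.
have := wlM u v; rewrite uv => ?.
by exists u; [lia|rewrite -uv mulKg uv; lia].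
Qed.

Lemma finite_ball n : exists l : seq G, forall x, (wl x <= n)%N -> x \in l.
Proof.
have /finite_seqP[s ES] := finS.
elim: n => [|n [l IH]].
  by exists [:: 1] => x; rewrite leqn0 => /eqP/wl0_eq ->; rewrite mem_head.
exists (l ++ [seq a * b | a <- s ++ [seq z^-1 | z <- s], b <- l]) => x xn.
rewrite mem_cat; have [/IH ->//|nx] := leqP (wl x) n.
apply/orP; right; have x1 : (1 <= wl x)%N by apply: leq_ltn_trans nx.
have [y y1 yx] := wl_split x1.
rewrite -[x](mulVKg y); apply: allpairs_f; last by apply: IH; rewrite yx; lia.
have [[[|z [|t l']]] [lS]] := word_lengthP y; rewrite y1 //= => _.
rewrite big_seq1 => <- _; rewrite mem_cat.
have sP t : S t -> t \in s by rewrite ES.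
have [/sP ->//|/sP zs] := lS _ (mem_head _ _).
by apply/orP; right; apply/mapP; exists z^-1; rewrite ?invgK.
Qed.

Lemma infinite_unbounded (A : set G) n : infinite_set A -> exists2 x, A x & (n < wl x)%N.
Proof.
move=> infA; apply: contrapT => no; apply: infA.
have [l lP] := finite_ball n.
apply: (@sub_finite_set _ _ [set` l]); last exact: finite_seq.
move=> x Ax; apply: lP; rewrite leqNgt; apply/negP => nx; apply: no.
by exists x.
Qed.

End WordMetricTheory.

Lemma rat_le_nat (c : rat) : exists n : nat, (c <= n%:R)%R.
Proof.
exists (Num.bound `|c|%R); apply: le_trans (ler_norm c) _.
by apply/ltW/archi_boundP/normr_ge0.
Qed.

Lemma seq_bound (T : eqType) (l : seq T) (F : T -> rat) :
  exists2 c : rat, (0 <= c)%R & forall x, x \in l -> (F x <= c)%R.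
Proof.
elim: l => [|x l [c c0 lc]]; first by exists 0%R.
exists (Num.max c (F x)) => [|y]; first by rewrite le_max c0.
by rewrite inE le_max => /orP[/eqP ->|/lc ->//]; rewrite lexx orbT.
Qed.

(** Pigeonhole: were each s absent from some rank F s on, no element of l would occur from the
    maximum of these ranks on. *)
Lemma infinitely_often_seq (T : eqType) (P : nat -> T -> Prop) (l : seq T) :
  (forall m, exists n, (m <= n)%N /\ exists2 s, s \in l & P n s) ->
  exists2 s, s \in l & forall m, exists2 n, (m <= n)%N & P n s.
Proof.
move=> io; apply: contrapT => no.
have /choice[F FP] : forall s, exists m, s \in l -> forall n, (m <= n)%N -> ~ P n s.
  move=> s; have [sl|] := boolP (s \in l); last by exists 0%N.
  apply: contrapT => no'; apply: no; exists s => // m.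
  apply: contrapT => no; apply: no'; exists m => _ n mn Pn.
  by apply: no; exists n.
have [n [mn [s sl Pn]]] := io (\max_(s <- l) F s)%N.
apply: (FP s sl n _ Pn); apply: leq_trans mn.
by rewrite (big_rem s) //= leq_max leqnn.
Qed.

Lemma infinite_uniq_seq (T : eqType) (A : set T) n : infinite_set A ->
  exists l : seq T, [/\ uniq l, size l = n & forall x, x \in l -> A x].
Proof.
move=> infA; elim: n => [|n [l [ul sl lA]]]; first by exists [::].
have [x Ax xl] : exists2 x, A x & x \notin l.
  apply: contrapT => no; apply: infA.
  apply: (@sub_finite_set _ _ [set` l]); last exact: finite_seq.
  move=> x Ax; apply/negPn/negP => xl; apply: no; by exists x.
exists (x :: l); split=> /=; rewrite ?xl ?sl // => y.
by rewrite inE => /orP[/eqP ->|/lA].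
Qed.

(** * Gromov products, geodesic rays and hyperbolicity *)

Section GromovProduct.
Variables (G : groupType) (S : set G).
Hypotheses (finS : finite_set S) (genS : generated S = [set: G]).
Implicit Types (x y z g : G) (n m k : nat) (r s : nat -> G).

Local Notation wl := (word_length S).

Definition len (x : G) : rat := ((wl x)%:R)%R.

(** The Gromov product with base point 1, in rational lengths so that estimates become linear
    arithmetic. *)
Definition gp (x y : G) : rat := ((len x + len y - len (x^-1 * y)) / 2)%R.

Lemma gromov_product1 x y : gromov_product S 1 x y = gp x y.
Proof.
by rewrite /gromov_product /gp /word_dist !mulg1 !(wlV genS).
Qed.

Lemma len1 : len 1 = 0%R.
Proof. by rewrite /len (wl1 genS). Qed.

Lemma len_ge0 x : (0 <= len x)%R.
Proof. exact: ler0n. Qed.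

Lemma lenV x : len x^-1 = len x.
Proof. by rewrite /len (wlV genS). Qed.

Lemma lenM x y : (len (x * y) <= len x + len y)%R.
Proof. by rewrite /len -natrD ler_nat (wlM genS). Qed.

Lemma lenMr x y : (len x <= len (x * y) + len y)%R.
Proof.
have := lenM (x * y) y^-1; rewrite lenV mulgK; exact.
Qed.

Lemma lenMl x y : (len y <= len (x * y) + len x)%R.
Proof.
have := lenM x^-1 (x * y); rewrite lenV mulKg addrC; exact.
Qed.

Lemma distC x y : len (x^-1 * y) = len (y^-1 * x).
Proof. by rewrite -lenV !grpE. Qed.

Lemma dist_tri x y z : (len (x^-1 * z) <= len (x^-1 * y) + len (y^-1 * z))%R.
Proof. by have := lenM (x^-1 * y) (y^-1 * z); rewrite !grpE. Qed.

Lemma dist_mul g x y : len ((g * x)^-1 * (g * y)) = len (x^-1 * y).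
Proof. by rewrite !grpE. Qed.

Lemma gpC x y : gp x y = gp y x.
Proof. by rewrite /gp distC (addrC (len x)). Qed.

Lemma gp_lel x y : (gp x y <= len x)%R.
Proof. have := lenM x (x^-1 * y); rewrite mulVKg /gp; lra. Qed.

Lemma gp_ler x y : (gp x y <= len y)%R.
Proof. rewrite gpC; exact: gp_lel. Qed.

Lemma gp_ge0 x y : (0 <= gp x y)%R.
Proof. have := lenM x^-1 y; rewrite lenV /gp; lra. Qed.

Lemma distE x y : len (x^-1 * y) = (len x + len y - 2 * gp x y)%R.
Proof. rewrite /gp; lra. Qed.

Lemma gp_mul g x y : (gp x y - len g <= gp (g * x) (g * y))%R.
Proof.
rewrite /gp dist_mul.
have := lenMl g x; have := lenMl g y; lra.
Qed.

Lemma gp_mulV g x y : (gp (g * x) (g * y) <= gp x y + len g)%R.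
Proof.
have := gp_mul g^-1 (g * x) (g * y); rewrite lenV !mulKg; lra.
Qed.

Lemma gp_mulr x y z : (gp x z - len y <= gp (x * y) z)%R.
Proof.
have h1 := dist_tri (x * y) x z; have h2 := lenMr x y.
have h3 : len ((x * y)^-1 * x) = len y by rewrite !grpE lenV.
rewrite /gp; lra.
Qed.

Lemma gp_mulr_le x y z : (gp (x * y) z <= gp x z + len y)%R.
Proof. have := gp_mulr (x * y) y^-1 z; rewrite lenV mulgK; lra. Qed.

(** The product of x^-1 and y measures the cancellation in x * y, seen as a path from 1 through
    x. *)
Lemma gp_step x y : gp x (x * y) = (len x - gp x^-1 y)%R.
Proof.
have h1 : len (x^-1 * (x * y)) = len y by rewrite !grpE.
have h2 : len (x^-1^-1 * y) = len (x * y) by rewrite invgK.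
rewrite /gp h1 h2 lenV; lra.
Qed.

(** The hypothesis places x on a geodesic from 1 to y, and Gromov products with z grow along that
    geodesic. *)
Lemma gp_prefix x y z : len y = (len x + len (x^-1 * y))%R -> (gp x z <= gp y z)%R.
Proof.
move=> h; have := dist_tri y x z; rewrite (distC y x) /gp; lra.
Qed.

Lemma gp_prefix_eq x y : len y = (len x + len (x^-1 * y))%R -> gp x y = len x.
Proof. move=> h; rewrite /gp; lra. Qed.

Lemma len_split x k : (k <= wl x)%N ->
  exists y, len y = (k%:R)%R /\ len x = (len y + len (y^-1 * x))%R.
Proof.
move=> kx; have [y yk yx] := wl_split genS kx; exists y.
rewrite /len yx yk; split=> //; rewrite -natrD; congr (_%:R)%R; lia.
Qed.

Lemma finite_len_ball (c : rat) : exists l : seq G, forall x, (len x <= c)%R -> x \in l.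
Proof.
have [n cn] := rat_le_nat c; have [l lP] := finite_ball finS genS n.
by exists l => x xc; apply: lP; rewrite -(ler_nat rat); apply: le_trans cn.
Qed.

Lemma infinite_len (A : set G) (c : rat) : infinite_set A ->
  exists2 x, A x & (c < len x)%R.
Proof.
move=> infA; have [n cn] := rat_le_nat c.
have [x Ax nx] := infinite_unbounded finS genS n infA; exists x => //.
by rewrite (le_lt_trans cn) // ltr_nat.
Qed.

Lemma ray_dist r i j : geodesic_ray S r -> (i <= j)%N ->
  len ((r i)^-1 * r j) = (j%:R - i%:R)%R.
Proof. by move=> gr ij; rewrite /len [wl _](gr _ _ ij) natrB. Qed.

Lemma translate_ray g r : geodesic_ray S r -> geodesic_ray S (fun i => g * r i).
Proof. by move=> gr i j ij; rewrite -(gr i j ij) /word_dist !grpE. Qed.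

Lemma asymptoticP r s : asymptotic S r s <->
  exists c : rat, forall i, (len ((r i)^-1 * s i) <= c)%R.
Proof.
split=> [[n h]|[c h]]; first by exists (n%:R)%R => i; rewrite /len ler_nat; apply: h.
have [n cn] := rat_le_nat c; exists n => i.
by rewrite -(ler_nat rat); apply: le_trans cn; apply: h.
Qed.

Lemma asymptotic_refl r : asymptotic S r r.
Proof. by apply/asymptoticP; exists 0%R => i; rewrite mulVg len1. Qed.

Lemma asymptotic_sym r s : asymptotic S r s -> asymptotic S s r.
Proof.
by move=> /asymptoticP[c h]; apply/asymptoticP; exists c => i; rewrite distC.
Qed.

Lemma asymptotic_trans r s t : asymptotic S r s -> asymptotic S s t -> asymptotic S r t.
Proof.
move=> /asymptoticP[c h] /asymptoticP[c' h']; apply/asymptoticP.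
exists (c + c')%R => i; apply: le_trans (dist_tri _ (s i) _) _; exact: lerD.
Qed.

Lemma asymptotic_translate g r s :
  asymptotic S r s -> asymptotic S (fun i => g * r i) (fun i => g * s i).
Proof.
move=> /asymptoticP[c h]; apply/asymptoticP; exists c => i; rewrite dist_mul; exact: h.
Qed.

(** A compactness argument: [Q y] says that y lies on geodesics from 1 to infinitely many x n. It
    holds for 1, and since the unit ball is finite, pigeonhole extends any such y by one letter.
    Iterating gives a ray issued from 1. *)
Lemma exists_limit_ray (x : nat -> G) :
  (forall c : rat, exists N, forall n, (N <= n)%N -> (c <= len (x n))%R) ->
  exists r, [/\ geodesic_ray S r, forall p, len (r p) = (p%:R)%R &
    forall p m, exists2 n, (m <= n)%N &
      len (x n) = (len (r p) + len ((r p)^-1 * x n))%R].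
Proof.
move=> xoo.
pose Q y := forall m, exists2 n, (m <= n)%N & len (x n) = (len y + len (y^-1 * x n))%R.
have Q1 : Q 1 by move=> m; exists m => //; rewrite len1 !grpE add0r.
have [l lP] := finite_len_ball 1%R.
have /choice[f fP] : forall y, exists z, Q y ->
    [/\ Q z, len z = (len y + 1)%R & len (y^-1 * z) = 1%R].
  move=> y; have [Qy|] := pselect (Q y); last by exists 1.
  have [|a _ aP] := @infinitely_often_seq _ (fun n a => [/\ len a = 1%R,
      len (y * a) = (len y + 1)%R &
      len (x n) = (len (y * a) + len ((y * a)^-1 * x n))%R]) l.
    move=> m; have [N NP] := xoo (len y + 1)%R.
    have [n + xn] := Qy (maxn m N); rewrite geq_max => /andP[mn /NP Nn].
    exists n; split=> //.
    have yx1 : (1 <= wl (y^-1 * x n))%N.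
      rewrite -(ler_nat rat) -/(len _); lra.
    have [a [a1 ax]] := len_split yx1.
    exists a; first by apply: lP; rewrite a1.
    have e : len ((y * a)^-1 * x n) = len (a^-1 * (y^-1 * x n)) by rewrite !grpE.
    have h1 := lenM y a; have h2 := lenMl (y * a)^-1 (x n).
    rewrite lenV in h2.
    rewrite a1 in h1 ax *; split=> //; lra.
  exists (y * a) => _; have [n _ [a1 ys _]] := aP 0%N.
  split=> //; last by rewrite mulKg.
  by move=> m; have [n' mn [_ _ ?]] := aP m; exists n'.
pose r n := iter n f 1.
have rQ n : Q (r n) by elim: n => //= n /fP[].
have rl n : len (r n) = (n%:R)%R.
  by elim: n => [|n IH]; [rewrite len1 | have [_ /= -> _] := fP _ (rQ n); rewrite IH -natr1].
have rd i k : (len ((r i)^-1 * r (i + k)%N) <= k%:R)%R.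
  elim: k => [|k IH]; first by rewrite addn0 mulVg len1.
  apply: le_trans (dist_tri _ (r (i + k)%N) _) _.
  have [_ _ /= h] := fP _ (rQ (i + k)%N); rewrite addnS /= h -natr1; lra.
exists r; split=> // i j ij.
apply/eqP; rewrite -(eqr_nat rat) -[X in (X == _)%R]/(len _) eq_le; apply/andP; split.
  by rewrite -{1}(subnKC ij); apply: rd.
have := lenM (r i) ((r i)^-1 * r j); rewrite mulVKg !rl natrB //; lra.
Qed.

Variable delta : rat.
Hypotheses (delta0 : (0 <= delta)%R)
  (hypS : forall w x y z, (Num.min (gromov_product S w x y) (gromov_product S w y z)
     - delta <= gromov_product S w x z)%R).

Lemma gp_hyp x y z : (gp x y - delta <= gp x z)%R \/ (gp y z - delta <= gp x z)%R.
Proof.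
have := hypS 1 x y z; rewrite !gromov_product1.
by case: (leP (gp x y) (gp y z)) => _; [left|right].
Qed.

(** This is the product condition based at w, translated by w^-1 and cleared of products. *)
Lemma four_point x y z w : let d a b := len (a^-1 * b) in
  (d x z + d y w <= d x y + d z w + 2 * delta)%R \/
  (d x z + d y w <= d y z + d x w + 2 * delta)%R.
Proof.
move=> d; rewrite /d.
have [h|h] := gp_hyp (w^-1 * x) (w^-1 * y) (w^-1 * z); move: h; rewrite /gp !dist_mul
  !(distC w); [left|right]; lra.
Qed.

(** As a is long and v turns away from a^-1, the element a * v follows a beyond distance c + delta
    from 1, whereas u has left a by then. *)
Lemma gp_turn u a v (c : rat) : (gp u a <= c)%R -> (gp a^-1 v <= c)%R ->
  (2 * c + delta < len a)%R -> (gp u (a * v) <= c + delta)%R.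
Proof.
move=> ua av al; have := gp_step a v; rewrite gpC => e.
by have [|] := gp_hyp u (a * v) a; lra.
Qed.

(** u and v still run together where z leaves u, so z leaves v at about the same place. *)
Lemma gp_follow u v z (c : rat) : (gp u z <= c)%R -> (c + delta < gp u v)%R ->
  (gp v z <= c + delta)%R.
Proof.
move=> uz uv; have [|] := gp_hyp u v z; lra.
Qed.

Lemma ray_gp r i j : geodesic_ray S r -> (i <= j)%N ->
  (i%:R - len (r 0%N) <= gp (r i) (r j))%R.
Proof.
move=> gr ij; rewrite /gp (ray_dist gr ij).
have := lenM (r 0%N)^-1 (r i); have := lenM (r 0%N)^-1 (r j).
rewrite (lenV (r 0%N)) !(ray_dist gr) //; lra.
Qed.

End GromovProduct.

(** * Ping-pong *)

Section PingPong.
Variables (G : groupType) (S : set G).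
Hypotheses (genS : generated S = [set: G]).
Variable delta : rat.
Hypotheses (delta0 : (0 <= delta)%R)
  (hypS : forall w x y z, (Num.min (gromov_product S w x y) (gromov_product S w y z)
     - delta <= gromov_product S w x z)%R).
Local Notation len := (len S).
Local Notation gp := (gp S).

Implicit Types (x y z g a b e t u : G).
Variables (P N : set G) (T : seq G) (c d : rat).
Hypotheses (sP : subgroup P) (NP : N `<=` P)
  (nN : forall g x, N x -> N (g * x * g^-1)) (TV : forall t, t \in T -> t^-1 \in T)
  (c0 : (0 <= c)%R) (d0 : (0 <= d)%R) (Nd : forall x, N x -> (len x <= d)%R)
  (TP : forall t a, t \in T -> P a -> (gp t a <= c)%R)
  (TT : forall t t', t \in T -> t' \in T -> t != t' -> (gp t t' <= c)%R)
  (Plong : forall a, P a -> ~ N a -> (2 * c + delta < len a)%R)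
  (Tlong : forall t, t \in T -> (4 * c + 2 * d + 5 * delta < len t)%R).

(* Words t_1 a_1 t_2 a_2 ... t_n a_n, with t_i in T and a_i in P, in which t_i a_i t_{i+1}
   never lies in P because of t_{i+1} = t_i^-1 and the normality of N. *)
Inductive reduced : G -> G -> Prop :=
| reduced1 t a : t \in T -> P a -> reduced t (t * a)
| reducedS t a t' y : t \in T -> P a -> reduced t' y -> (N a -> t' != t^-1) ->
    reduced t (t * (a * y)).

(** Either a lies in N, and by normality moves past t as a short right factor, or a is long and
    [gp_turn] applies. *)
Lemma gp_corner u a t : t \in T -> P a -> (forall b, P b -> (gp u b <= c)%R) ->
  (N a -> (gp u t <= c)%R) -> (gp u (a * t) <= c + d + delta)%R.
Proof.
move=> tT Pa uP ut; have [Na|nNa] := pselect (N a).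
  pose b : G := t^-1 * a * t^-1^-1.
  have lb : (len b <= d)%R := Nd (nN t^-1 Na).
  have -> : a * t = t * b by rewrite /b !grpE.
  have := gp_mulr_le genS t b u; have := ut Na.
  rewrite !(gpC genS _ u); move: delta0 c0 d0; lra.
have h := gp_turn genS hypS (uP a Pa) _ (Plong Pa nNa).
have := h t; rewrite (gpC genS a^-1); move=> /(_ (TP tT (subgroupV sP Pa))); move: delta0 c0 d0; lra.
Qed.

Lemma gp_corner_word u a t y : t \in T -> P a -> (len t - (c + d + 2 * delta) <= gp t y)%R ->
  (gp u (a * t) <= c + d + delta)%R -> (gp u (a * y) <= c + d + 2 * delta)%R.
Proof.
move=> tT Pa ty uat; have tl := Tlong tT.
have ta : (gp t a^-1 <= c)%R by apply: TP => //; apply: subgroupV.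
have ya : (gp y a^-1 <= c + delta)%R by apply: (gp_follow genS hypS ta); move: delta0 c0 d0; lra.
have e1 := distE S a^-1 t; have e2 := distE S a^-1 y.
rewrite !(lenV genS) !(gpC genS a^-1) !invgK in e1 e2.
(* This product equals [len a + gp t y - gp t a^-1 - gp y a^-1]; the bound in [Tlong] is chosen to
   make it large enough. *)
have big : (c + d + delta + delta < gp (a * t) (a * y))%R.
  rewrite {1}/gp dist_mul e1 e2 distE; have := len_ge0 S a; move: delta0 c0 d0; lra.
have uat' : (gp (a * t) u <= c + d + delta)%R by rewrite gpC.
have := gp_follow genS hypS uat' big; rewrite gpC //; move: delta0 c0 d0; lra.
Qed.

(** Induction on the word: by the corner estimates, what comes after t turns away from t^-1, so only
    a bounded end of t is cancelled. *)
Lemma reduced_gp t y : reduced t y ->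
  t \in T /\ (len t - (c + d + 2 * delta) <= gp t y)%R.
Proof.
elim=> {t y} [t a tT Pa|t a t' y tT Pa _ [t'T t'y] Na]; split=> //.
  by rewrite (gp_step genS); have := TP (TV tT) Pa; move: delta0 c0 d0; lra.
rewrite (gp_step genS); have := gp_corner_word t'T Pa t'y.
move=> /(_ t^-1); rewrite lerD2l lerN2; apply.
apply: gp_corner => // [b|/Na tt']; first by apply: TP; apply: TV.
by apply: TT; rewrite ?TV // eq_sym.
Qed.

(** P together with the normal forms a t_1 a_1 ... t_n a_n. Left multiplication by P and by T
    preserves it, so it contains the subgroup generated by both. *)
Let Q x := P x \/ exists a t y, [/\ P a, reduced t y & x = a * y].

Let mulPQ a x : P a -> Q x -> Q (a * x).
Proof.
move=> Pa [Px|[b [t [y [Pb ry ->]]]]]; [left|right]; first exact: subgroupM.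
by exists (a * b), t, y; rewrite mulgA; split=> //; apply: subgroupM.
Qed.

Let mulTQ t x : t \in T -> Q x -> Q (t * x).
Proof.
move=> tT [Px|[a [t' [y [Pa ry ->]]]]].
  right; exists 1, t, (t * x); rewrite mul1g; split=> //; first exact: subgroup1.
  exact: reduced1.
have [[Na tt']|no] := pselect (N a /\ t' = t^-1); last first.
  right; exists 1, t, (t * (a * y)); rewrite mul1g; split=> //; first exact: subgroup1.
  by apply: reducedS ry _ => // Na; apply/eqP => tt'; apply: no.
(* The cancelling piece t a t^-1 lies in N, so it merges with the letter of P that follows. *)
have Pa' : P (t * a * t^-1) by apply/NP/nN.
case: t' y / ry tt' => [s b _ Pb ->|s b s' z _ Pb rz _ ->].
  by rewrite !mulgA; left; apply: subgroupM.
right; exists (t * a * t^-1 * b), s', z; rewrite !mulgA; split=> //.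
exact: subgroupM.
Qed.

Lemma ping_pong e x :
  (forall a, P a -> (gp e a <= c)%R) -> (forall t, t \in T -> (gp e t <= c)%R) ->
  generated (P `|` [set` T]) x -> (gp e x <= c + d + 2 * delta)%R.
Proof.
(* Preserving [Q] under both x and x^-1 is a subgroup condition; applied to 1 it puts x in [Q]. *)
move=> eP eT; pose K := [set x | forall q, Q q -> Q (x * q) /\ Q (x^-1 * q)].
have sK : subgroup K.
  split=> [q|u v Ku Kv q Qq]; first by rewrite invg1 mul1g.
  rewrite invgF -!mulgA; split.
    by apply: (Ku _ _).1; apply: (Kv _ _).2.
  by apply: (Kv _ _).1; apply: (Ku _ _).2.
move=> gx; have /(_ 1)[] : K x.
  apply: (generated_sub sK _ gx) => u [Pu|Tu] q Qq; first by split; apply: mulPQ => //; apply: subgroupV.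
  by split; apply: mulTQ => //; apply: TV.
  by left; apply: (subgroup1 sP).
rewrite mulg1 => -[/eP ex|[a [t [y [Pa ry ->]]]]] _; first by move: delta0 c0 d0; lra.
have [tT ty] := reduced_gp ry; apply: (gp_corner_word tT Pa ty).
by apply: gp_corner => // _; apply: eT.
Qed.

End PingPong.

(** * Stabilizers of boundary points *)

Section Stabilizers.
Variables (G : groupType) (S : set G).
Hypotheses (finS : finite_set S) (genS : generated S = [set: G]).
Variable delta : rat.
Hypotheses (delta0 : (0 <= delta)%R)
  (hypS : forall w x y z, (Num.min (gromov_product S w x y) (gromov_product S w y z)
     - delta <= gromov_product S w x z)%R).
Local Notation len := (len S).
Local Notation gp := (gp S).
Implicit Types (x y z g h u : G) (r s : nat -> G).

(** By contraposition: if the products are unbounded, then for each i some r p and s q run together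
    beyond i, which forces r i and s i to be uniformly close. The constant [a] accounts for the rays
    not starting at 1. *)
Lemma ray_gp_bounded r s : geodesic_ray S r -> geodesic_ray S s ->
  ~ asymptotic S r s -> exists c : rat, forall p q, (gp (r p) (s q) <= c)%R.
Proof.
move=> gr gs; apply: contra_notP => no; apply/asymptoticP.
pose a := (len (r 0%N) + len (s 0%N))%R.
exists (4 * a + 4 * delta)%R => i.
have /existsNP[p /existsNP[q /negP]] : ~ forall p q, (gp (r p) (s q) <= i%:R + a)%R.
  by move=> h; apply: no; exists (i%:R + a)%R.
rewrite -ltNge => big.
have r0 := len_ge0 S (r 0%N); have s0 := len_ge0 S (s 0%N).
have lr j : (len (r j) <= j%:R + len (r 0%N))%R.
  have := lenM genS (r 0%N) ((r 0%N)^-1 * r j).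
  by rewrite mulVKg (ray_dist gr) //; lra.
have ls j : (len (s j) <= j%:R + len (s 0%N))%R.
  have := lenM genS (s 0%N) ((s 0%N)^-1 * s j).
  by rewrite mulVKg (ray_dist gs) //; lra.
have ip : (i <= p)%N.
  rewrite -(ler_nat rat); have := gp_lel genS (r p) (s q); have := lr p.
  by rewrite /a in big; lra.
have iq : (i <= q)%N.
  rewrite -(ler_nat rat); have := gp_ler genS (r p) (s q); have := ls q.
  by rewrite /a in big; lra.
have h1 := ray_gp genS gr ip; have h2 := ray_gp genS gs iq.
rewrite (gpC genS) in h2.
have h3 := lr i; have h4 := ls i.
rewrite distE.
have D0 := delta0.
have [k1|k1] := gp_hyp genS hypS (r i) (r p) (s i); first by rewrite /a in big *; lra.
have [k2|k2] := gp_hyp genS hypS (r p) (s q) (s i); rewrite /a in big *; lra.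
Qed.

Definition stab r : set G := [set g | asymptotic S (fun i => g * r i) r].

Lemma stab_subgroup r : subgroup (stab r).
Proof.
have stV g : stab r g -> stab r g^-1.
  move=> /(asymptotic_translate g^-1)/(asymptotic_sym genS) h.
  apply: asymptotic_trans h _ => //.
  by apply/asymptoticP; exists 0%R => i; rewrite mulKg mulVg (len1 genS).
split=> [|g h gr /stV hr].
  by apply/asymptoticP; exists 0%R => i; rewrite mul1g mulVg (len1 genS).
apply: asymptotic_trans gr => //.
have /asymptoticP[c hc] := asymptotic_translate g hr.
by apply/asymptoticP; exists c => i; rewrite -(mulgA g).
Qed.

Variable r : nat -> G.
Hypothesis gr : geodesic_ray S r.

(* Far along the ray r, the element g moves every r (t + a) within k of r (t + b): it
   shifts r by the signed amount b - a, up to an error k. *)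
Definition shifts (k : rat) g (a b : nat) : Prop :=
  exists m, forall t, (m <= t)%N -> (len ((g * r (t + a)%N)^-1 * r (t + b)%N) <= k)%R.

(** Only b - a matters. Starting at m + a keeps the truncated subtraction in the reindexing
    harmless. *)
Lemma shifts_eq k g (a b a' b' : nat) : (a + b' = a' + b)%N ->
  shifts k g a b -> shifts k g a' b'.
Proof.
move=> e [m h]; exists (m + a)%N => t mt.
have := h (t + a' - a)%N; rewrite (_ : t + a' - a + a = t + a')%N; last lia.
by rewrite (_ : t + a' - a + b = t + b')%N; last lia; apply; lia.
Qed.

Lemma shifts1 (a b : nat) : shifts (`|b%:R - a%:R|)%R 1 a b.
Proof.
exists 0%N => t _; rewrite mul1g; have [ab|/ltnW ba] := leqP a b.
  by rewrite (ray_dist gr) ?leq_add2l // !natrD; apply: le_trans (ler_norm _); lra.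
rewrite (distC genS) (ray_dist gr) ?leq_add2l // !natrD distrC.
by apply: le_trans (ler_norm _); lra.
Qed.

Lemma shiftsM k k' g h (a b a' b' : nat) : shifts k g a b -> shifts k' h a' b' ->
  shifts (k + k') (g * h) (a + a') (b + b').
Proof.
move=> hg hh.
have [m hm] : shifts k g (a + b') (b + b') by apply: shifts_eq hg; lia.
have [n hn] : shifts k' h (a + a') (a + b') by apply: shifts_eq hh; lia.
exists (maxn m n) => t; rewrite geq_max => /andP[/hm h1 /hn h2].
apply: le_trans (dist_tri genS _ (g * r (t + (a + b'))%N) _) _.
by rewrite -(mulgA g) dist_mul addrC; apply: lerD.
Qed.

Lemma shiftsV k g (a b : nat) : shifts k g a b -> shifts k g^-1 b a.
Proof.
move=> [m h]; exists m => t /h; rewrite (distC genS).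
by rewrite -(dist_mul S g (g^-1 * _)) mulVKg.
Qed.

Lemma shifts_diff k k' g (a b a' b' : nat) : shifts k g a b -> shifts k' g a' b' ->
  (`|(b%:R - a%:R) - (b'%:R - a'%:R)| <= k + k')%R.
Proof.
move=> h /shiftsV h'; have [m] := shiftsM h h'; rewrite mulgV => /(_ m (leqnn _)).
rewrite mul1g; have [ab|/ltnW ba] := leqP (a + b') (b + a').
  rewrite (ray_dist gr) ?leq_add2l // !natrD.
  have : ((a + b')%N%:R <= (b + a')%N%:R :> rat)%R by rewrite ler_nat.
  by rewrite !natrD => *; rewrite ger0_norm; lra.
rewrite (distC genS) (ray_dist gr) ?leq_add2l // !natrD.
have : ((b + a')%N%:R <= (a + b')%N%:R :> rat)%R by rewrite ler_nat.
by rewrite !natrD => *; rewrite ler0_norm; lra.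
Qed.

(** Such g moves r t by no more than 2 k for t large. More such elements than the ball of radius 2 k
    has points would, at a common t, give too many distinct conjugates (r t)^-1 g (r t) in that
    ball. *)
Lemma finite_shifts k : finite_set [set g | exists a b,
  shifts k g a b /\ (`|b%:R - a%:R| <= k)%R].
Proof.
have [l lP] := finite_len_ball finS genS (k + k)%R.
apply: contrapT => /(infinite_uniq_seq (size l).+1)[L [uL sL LP]].
have /choice[m mP] : forall g, exists m, g \in L ->
    forall t, (m <= t)%N -> (len ((r t)^-1 * (g * r t)) <= k + k)%R.
  move=> g; have [/LP[a [b [h ab]]]|_] := boolP (g \in L); last by exists 0%N.
  have [m hm] := shiftsM (shifts1 b a) h.
  exists (m + (a + b))%N => _ t mt; rewrite (distC genS).
  have := hm (t - (a + b))%N; rewrite mul1g (addnC b) subnK; last lia.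
  by move=> /(_ ltac:(lia)) h'; apply: le_trans h' _; rewrite distrC lerD2r.
pose t := (\max_(g <- L) m g)%N.
pose f g := (r t)^-1 * (g * r t).
have fl x : x \in map f L -> x \in l.
  move=> /mapP[g gL ->]; apply: lP; apply: mP => //.
  by rewrite /t (big_rem g) //= leq_max leqnn.
have := uniq_leq_size _ fl.
rewrite size_map sL ltnn map_inj_uniq // => [/(_ uL)//|x y].
by move=> /mulgI/mulIg.
Qed.

(** 6 delta to reach the ray, and 12 delta to compare parameters along it. *)
Let rho := (18 * delta)%R.

(** Long initial pieces of r and g r have ends within C of each other, so points of g r far from
    those ends are within 6 delta of r, a bound that does not depend on C and hence not on g. *)
Lemma stab_shifts g : stab r g -> exists a b, shifts rho g a b.
Proof.
have D0 := delta0.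
move=> /asymptoticP[c0 hc0]; have [C cC] := rat_le_nat (c0 + 2 * delta + 1)%R.
have hc i : (len ((g * r i)^-1 * r i) <= C%:R - 2 * delta - 1)%R.
  by have := hc0 i; lra.
have {cC}C0 : (1 + 2 * delta <= C%:R)%R.
  by have := hc 0%N; have := len_ge0 S ((g * r 0%N)^-1 * r 0%N); lra.
have near t : (2 * C <= t)%N -> exists t', [/\ (t <= t' + C)%N, (t' <= t + C)%N
    & (len ((g * r t)^-1 * r t') <= 6 * delta)%R].
  (* T leaves a margin of 3 C beyond t, and the point of r close to g r t is the one at the same
     distance t' from r 0. *)
  move=> Ct; pose T := (t + 3 * C)%N; pose t' := word_length S ((g * r t)^-1 * r 0%N).
  have Et' : (t'%:R)%R = len ((g * r t)^-1 * r 0%N) by [].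
  have CtR : (2 * C%:R <= t%:R :> rat)%R by rewrite -natrM ler_nat.
  have TR : (T%:R = t%:R + 3 * C%:R :> rat)%R by rewrite natrD natrM.
  have tT : (t <= T)%N by rewrite /T; lia.
  have C0' := hc 0%N; have CT := hc T.
  have d0 : len ((g * r t)^-1 * (g * r 0%N)) = (t%:R)%R.
    by rewrite dist_mul (distC genS) (ray_dist gr) // subr0.
  have dT : len ((g * r t)^-1 * (g * r T)) = (T%:R - t%:R)%R.
    by rewrite dist_mul (ray_dist gr).
  have g0 := dist_tri genS (g * r t) (g * r 0%N) (r 0%N).
  have g0' := dist_tri genS (g * r t) (r 0%N) (g * r 0%N).
  have gT := dist_tri genS (g * r t) (r T) (g * r T).
  rewrite !(distC genS (r _)) in g0' gT.
  have tt' : (t <= t' + C)%N.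
    by rewrite -(ler_nat rat) natrD Et' (distC genS); rewrite (distC genS (g * r t) (r 0%N)) in g0'; lra.
  have t't : (t' <= t + C)%N.
    by rewrite -(ler_nat rat) natrD Et'; lra.
  exists t'; split=> //.
  have t'T : (t' <= T)%N by rewrite /T; lia.
  have r0T := ray_dist gr (leq0n T); have r0t' := ray_dist gr (leq0n t').
  have rt'T := ray_dist gr t'T; have rg0T : len ((g * r 0%N)^-1 * (g * r T)) = (T%:R)%R.
    by rewrite dist_mul (ray_dist gr) // subr0.
  (* This says that the Gromov product of r 0 and r T based at g * r t is at most 2 delta. *)
  have small : (len ((g * r t)^-1 * r T) <= T%:R - t'%:R + 4 * delta)%R.
    have [u Eu] : exists u : G, u = g * r t by exists (g * r t).
    rewrite -Eu in d0 dT Et' g0 g0' gT *.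
    have r0u := gp_hyp genS hypS (u^-1 * r 0%N) (u^-1 * r T) (u^-1 * (g * r T)).
    have gr0u := gp_hyp genS hypS (u^-1 * (g * r 0%N)) (u^-1 * r 0%N) (u^-1 * (g * r T)).
    rewrite /gp !dist_mul r0T d0 dT subr0 in gr0u.
    rewrite /gp !dist_mul r0T dT subr0 (distC genS (r T)) in r0u.
    case: gr0u => [?|?]; first lra.
    case: r0u => [?|?]; lra.
  have := four_point genS hypS (g * r t) (r 0%N) (r t') (r T).
  rewrite /= -Et' r0T r0t' rt'T; case=> ?; lra.
(* The amount is read off at time 2 C. From there to time i + 2 C both rays advance by i, up to the
   errors 6 delta at the two ends. *)
have [b [_ b0 hb]] := near (2 * C)%N (leqnn _).
exists (2 * C)%N, b, (2 * C)%N => i iC.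
have [b' [b1 b2 hb']] := near (i + 2 * C)%N (leq_addl _ _).
have h1 := dist_tri genS (g * r (i + 2 * C)%N) (r b') (r (i + b)%N).
have h2 := dist_tri genS (r b) (g * r (2 * C)%N) (r b').
have h3 := dist_tri genS (g * r (2 * C)%N) (g * r (i + 2 * C)%N) (r b').
have h4 := dist_tri genS (g * r (2 * C)%N) (r b') (g * r (i + 2 * C)%N).
have h5 := dist_tri genS (g * r (2 * C)%N) (r b) (r b').
have bb' : (b <= b')%N by lia.
have iCi : (2 * C <= i + 2 * C)%N by apply: leq_addl.
rewrite dist_mul !(distC genS (r _) (g * _)) !(ray_dist gr bb') (ray_dist gr iCi) natrD in h2 h3 h4 h5.
rewrite /rho; apply: le_trans h1 _.
have [le|/ltnW le] := leqP b' (i + b).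
  rewrite (ray_dist gr le) natrD; lra.
rewrite (distC genS (r b')) (ray_dist gr le) natrD; lra.
Qed.

(** The signed amount as one rational number, a homomorphism up to bounded error by [ShM], [ShV] and
    [Sh_diff]. *)
Let Sh k g (x : rat) := exists a b, x = (b%:R - a%:R)%R /\ shifts k g a b.

Let ShM k k' g h (x y : rat) : Sh k g x -> Sh k' h y -> Sh (k + k') (g * h) (x + y)%R.
Proof.
move=> [a [b [-> ab]]] [a' [b' [-> ab']]]; exists (a + a')%N, (b + b')%N.
by split; [rewrite !natrD; lra | apply: shiftsM].
Qed.

Let ShV k g (x : rat) : Sh k g x -> Sh k g^-1 (- x)%R.
Proof.
by move=> [a [b [-> ab]]]; exists b, a; split; [lra | apply: shiftsV].
Qed.

Let Sh_diff k k' g (x y : rat) : Sh k g x -> Sh k' g y -> (`|x - y| <= k + k')%R.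
Proof. by move=> [a [b [-> ab]]] [a' [b' [-> ab']]]; apply: shifts_diff ab ab'. Qed.

Let Sh_finite k k' : (k <= k')%R ->
  exists l : seq G, forall g (x : rat), Sh k g x -> (`|x| <= k')%R -> g \in l.
Proof.
move=> kk; have /finite_seqP[l E] := finite_shifts k'.
exists l => g x [a [b [-> [m h]]]] xk.
have : [set` l] g by rewrite -E; exists a, b; split=> //; exists m => t /h; lra.
by [].
Qed.

Let Sh_stab g : stab r g -> exists x : rat, Sh rho g x.
Proof. by move=> /stab_shifts[a [b h]]; exists (b%:R - a%:R)%R, a, b. Qed.

(** Bounded amounts occur for finitely many elements only, so the infinite B contains some z with
    amount s > 3 rho + 1. The amounts of z^n then increase with bounded gaps, whence z has infinite
    order and every g in the stabilizer agrees with a power of z up to a finite set. *)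
Lemma stab_cyclic B : subgroup B -> infinite_set B -> B `<=` stab r ->
  exists z, [/\ B z, infinite_set (generated [set z]) &
    exists F, covers F (generated [set z]) (stab r)].
Proof.
move=> sB infB Bst.
have rho0 : (0 <= rho)%R by rewrite /rho; move: delta0; lra.
have [z [s [Bz zs s3]]] : exists z (s : rat), [/\ B z, Sh rho z s & (3 * rho + 1 < s)%R].
  apply: contrapT => no; apply: infB.
  have [|l lP] := @Sh_finite rho (5 * rho + 1)%R; first lra.
  apply: (@sub_finite_set _ _ [set` l]); last exact: finite_seq.
  have bound g (x : rat) : B g -> Sh rho g x -> (x <= 3 * rho + 1)%R.
    by move=> Bg gx; rewrite leNgt; apply/negP => h; apply: no; exists g, x.
  move=> g Bg; have [x gx] := Sh_stab (Bst g Bg).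
  apply: (lP g x gx); have h1 := bound g x Bg gx.
  have h2 := bound _ _ (subgroupV sB Bg) (ShV gx).
  by rewrite ler_norml; apply/andP; split; lra.
have stz n : stab r (z ^+ n) by apply: Bst; apply: subgroupX.
have /choice[x xP] n := Sh_stab (stz n).
have step n : (x n + 1 <= x n.+1 <= x n + s + 3 * rho)%R.
  have h := xP n.+1; rewrite expgS in h.
  have := Sh_diff h (ShM zs (xP n)); rewrite ler_norml => /andP[h1 h2].
  by apply/andP; split; lra.
have mono n k : (x n + k%:R <= x (n + k)%N)%R.
  elim: k => [|k IH]; first by rewrite addr0 addn0.
  by have /andP[h _] := step (n + k)%N; rewrite addnS -natr1; lra.
have x0 : (`|x 0%N| <= rho)%R.
  have h : Sh 0 1 0%R.
    by exists 0%N, 0%N; split; [rewrite subrr|have := shifts1 0 0; rewrite subrr normr0].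
  by have := Sh_diff (xP 0%N) h; rewrite subr0 addr0.
have genX n : generated [set z] (z ^+ n).
  by apply: (subgroupX n (subgroup_generated _)); apply: sub_generated.
exists z; split=> //.
  (* Equal elements have amounts within 2 rho of each other, so exponents are spaced by q to keep
     the powers distinct. *)
  have [q qP] := rat_le_nat (2 * rho + 1)%R.
  have inj i j : z ^+ (q * i) = z ^+ (q * j) -> (i <= j)%N.
    move=> e; rewrite leqNgt; apply/negP => ji.
    have := Sh_diff (xP (q * i)%N); rewrite e => /(_ _ _ (xP (q * j)%N)).
    have := mono (q * j)%N (q * i - q * j)%N.
    rewrite subnKC -?mulnBr; last by rewrite leq_mul2l ltnW ?orbT.
    have : ((q * 1)%N%:R <= (q * (i - j))%N%:R :> rat)%R.
      by rewrite ler_nat leq_mul2l subn_gt0 ji orbT.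
    rewrite muln1 => h1 h2; rewrite ler_norml => /andP[h3 h4].
    by move: qP rho0 h1 h2 h3 h4; lra.
  move=> /finite_seqP[l E].
  have := @uniq_leq_size _ [seq z ^+ (q * i) | i <- iota 0 (size l).+1] l.
  rewrite size_map size_iota ltnn map_inj_uniq ?iota_uniq => [|i j e]; last first.
    by apply/eqP; rewrite eqn_leq !inj.
  move=> h; have // : false; apply: (h isT) => _ /mapP[i _ ->].
  by have : [set` l] (z ^+ (q * i)) by rewrite -E; apply: genX.
(* Take the first n with y <= x n; the last jump is no more than s + 3 rho. *)
have hit (y : rat) : (0 <= y)%R -> exists n, (`|y - x n| <= s + 4 * rho)%R.
  move=> y0.
  have ex : exists n, (y <= x n)%R.
    have [n hn] := rat_le_nat (y + rho)%R; exists n.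
    by have := mono 0%N n; rewrite add0n; move: x0; rewrite ler_norml => /andP[]; lra.
  case: (ex_minnP ex) => -[|n] yn nmin.
    exists 0%N; move: x0; rewrite !ler_norml => /andP[h1 h2].
    by apply/andP; split; lra.
  exists n.+1; have /andP[h1 h2] := step n.
  have : (x n < y)%R by rewrite ltNge; apply/negP => /nmin; rewrite ltnn.
  by move=> h3; rewrite ler_norml; apply/andP; split; lra.
have [|l lP] := @Sh_finite (rho + rho)%R (s + 4 * rho)%R; first lra.
exists l => g gst; have [y gy] := Sh_stab gst.
have [y0|y0] := leP 0%R y.
  have [n yn] := hit y y0.
  exists (g * (z ^+ n)^-1); first exact: (lP _ _ (ShM gy (ShV (xP n)))).
  by rewrite !grpE.
have [|n yn] := hit (- y)%R; first lra.
exists (g * z ^+ n).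
  by apply: (lP _ _ (ShM gy (xP n))); rewrite -normrN opprD.
rewrite invgM mulgVK; exact: (subgroupV (subgroup_generated _) (genX n)).
Qed.

End Stabilizers.

Lemma covers_finite (G : groupType) (Y : seq G) (L K : set G) :
  covers Y L K -> finite_set L -> finite_set K.
Proof.
move=> cov /finite_seqP[l E].
apply: (@sub_finite_set _ _ [set` [seq y * x | y <- Y, x <- l]]); last exact: finite_seq.
move=> x /cov[y yY Lx]; have : [set` l] (y^-1 * x) by rewrite -E.
by rewrite /= => xl; rewrite -[x](mulVKg y); apply: allpairs_f.
Qed.

(** * Dynamics on the boundary *)

Section Boundary.
Variables (G : groupType) (S : set G).
Hypotheses (finS : finite_set S) (genS : generated S = [set: G]).
Variable delta : rat.
Hypotheses (delta0 : (0 <= delta)%R)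
  (hypS : forall w x y z, (Num.min (gromov_product S w x y) (gromov_product S w y z)
     - delta <= gromov_product S w x z)%R).
Local Notation len := (len S).
Local Notation gp := (gp S).
Local Notation stab := (stab S).
Implicit Types (x y z g h u w : G) (r s : nat -> G).

(** The stabilizer is finite, or virtually cyclic by [stab_cyclic] with B the whole stabilizer; G
    inherits this from a subgroup of finite index. *)
Lemma covers_stab_elementary r Y : geodesic_ray S r ->
  covers Y (stab r) [set: G] -> elementary G.
Proof.
move=> gr cov.
have [fin|inf] := pselect (finite_set (stab r)); first by left; apply: covers_finite cov fin.
have [z [_ infz [F cF]]] :=
  stab_cyclic finS genS delta0 hypS gr (stab_subgroup genS r) inf (@subset_refl _ _).
right; exists z; split=> //.
by apply: (covers_finite_index (subgroup_generated _) _ (covers_trans cov cF)).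
Qed.

Lemma asymptotic_translates g h r :
  asymptotic S (fun i => g * r i) (fun i => h * r i) -> stab r (h^-1 * g).
Proof.
move=> /(asymptotic_translate h^-1)/asymptoticP[c hc]; apply/asymptoticP.
by exists c => i; have := hc i; rewrite mulKg (mulgA h^-1).
Qed.

(** If no further translate had a new endpoint, the f i would cover G by cosets of the
    stabilizer. *)
Lemma orbit_infinite r n : ~ elementary G -> geodesic_ray S r ->
  exists f : nat -> G, forall i j, (i < j < n)%N -> ~ stab r ((f i)^-1 * f j).
Proof.
move=> nel gr; elim: n => [|n [f fP]]; first by exists (fun=> 1) => i j; rewrite andbF.
have [g gP] : exists g, forall i, (i < n)%N -> ~ stab r ((f i)^-1 * g).
  apply: contrapT => no; apply: nel.
  apply: (@covers_stab_elementary r [seq f i | i <- iota 0 n]) => // g _.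
  apply: contrapT => no'; apply: no; exists g => i ilt st; apply: no'.
  by exists (f i) => //; apply: map_f; rewrite mem_iota.
exists (fun i => if (i < n)%N then f i else g) => i j /andP[ij].
rewrite ltnS leq_eqVlt => /orP[/eqP jn|jn].
  by rewrite jn ltnn -jn ij; apply: gP; rewrite -jn.
by rewrite jn (ltn_trans ij jn); apply: fP; rewrite ij.
Qed.

Lemma translates_gp_bounded r n (f : nat -> G) : geodesic_ray S r ->
  (forall i j, (i < j < n)%N -> ~ stab r ((f i)^-1 * f j)) ->
  exists2 c : rat, (0 <= c)%R & forall i j p q, (i < n)%N -> (j < n)%N -> i != j ->
    (gp (f i * r p) (f j * r q) <= c)%R.
Proof.
move=> gr fP.
have /choice[c cP] : forall ij : nat * nat, exists c : rat, (ij.1 < ij.2 < n)%N ->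
    forall p q, (gp (f ij.1 * r p) (f ij.2 * r q) <= c)%R.
  move=> [i j] /=; have [/fP nst|_] := boolP (i < j < n)%N; last by exists 0%R.
  have [|c cP] := ray_gp_bounded genS delta0 hypS (translate_ray (f i) gr)
    (translate_ray (f j) gr); last by exists c.
  by move=> /(asymptotic_sym genS)/asymptotic_translates.
have [d d0 dP] := seq_bound [seq (i, j) | i <- iota 0 n, j <- iota 0 n] c.
exists d => // i j p q iN jN; rewrite neq_ltn => /orP[ij|ji].
  apply: le_trans (dP (i, j) _); first by apply: (cP (i, j)); rewrite /= ij.
  by apply: allpairs_f; rewrite mem_iota.
rewrite (gpC genS); apply: le_trans (dP (j, i) _); first by apply: (cP (j, i)); rewrite /= ji.
by apply: allpairs_f; rewrite mem_iota.
Qed.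

(* Both 1 and g are coarse centres of the ideal triangle spanned by the three rays. *)
Lemma tripod_bounded r0 r1 r2 (c : rat) g :
  geodesic_ray S r0 -> geodesic_ray S r1 -> geodesic_ray S r2 ->
  (forall p q, (gp (r0 p) (r1 q) <= c)%R) -> (forall p q, (gp (r0 p) (r2 q) <= c)%R) ->
  (forall p q, (gp (r1 p) (r2 q) <= c)%R) ->
  stab r0 g -> stab r1 g -> stab r2 g -> (len g <= 2 * c + 6 * delta)%R.
Proof.
move=> gr0 gr1 gr2 c01 c02 c12 st0 st1 st2.
have D0 := delta0.
have close r : geodesic_ray S r -> stab r g ->
    exists m, forall i, (m <= i)%N -> (c + 2 * delta < gp (r i) (g^-1 * r i))%R.
  move=> gr /asymptoticP[k hk].
  have [m mk] := rat_le_nat (c + 2 * delta + len (r 0%N) + len g + k + 1)%R.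
  exists m => i; rewrite -(ler_nat rat) => mi.
  have h1 := lenM genS (r 0%N)^-1 (r i); rewrite (ray_dist gr) // (lenV genS) in h1.
  have h2 := lenM genS g (g^-1 * r i); rewrite mulVKg in h2.
  have h3 := hk i; rewrite -(dist_mul S g^-1) mulKg in h3.
  have h4 := len_ge0 S ((r i)^-1 * (g^-1 * r i)); have h5 := len_ge0 S g.
  rewrite /gp; lra.
have [m0 m0P] := close r0 gr0 st0.
have [m1 m1P] := close r1 gr1 st1.
have [m2 m2P] := close r2 gr2 st2.
pose i := (m0 + m1 + m2)%N.
have {m0P}h0 : (c + 2 * delta < gp (r0 i) (g^-1 * r0 i))%R by apply: m0P; rewrite /i; lia.
have {m1P}h1 : (c + 2 * delta < gp (r1 i) (g^-1 * r1 i))%R by apply: m1P; rewrite /i; lia.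
have {m2P}h2 : (c + 2 * delta < gp (r2 i) (g^-1 * r2 i))%R by apply: m2P; rewrite /i; lia.
have {c01}c01 := c01 i i; have {c02}c02 := c02 i i; have {c12}c12 := c12 i i.
move: (r0 i) (r1 i) (r2 i) h0 h1 h2 c01 c02 c12 => x0 x1 x2 h0 h1 h2 c01 c02 c12.
have push x y : (c + 2 * delta < gp x (g^-1 * x))%R -> (c + 2 * delta < gp y (g^-1 * y))%R ->
    (gp x y <= c)%R -> (gp (g^-1 * x) (g^-1 * y) <= c + 2 * delta)%R.
  move=> hx hy xy.
  have h : (gp y (g^-1 * x) <= c + delta)%R.
    by rewrite (gpC genS); apply: (gp_follow genS hypS xy); lra.
  have := gp_follow genS hypS h; move=> /(_ (g^-1 * y)) h'.
  by rewrite (gpC genS); apply: le_trans (h' _) _; lra.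
have one x y z (k : rat) : (gp x y <= k)%R -> (gp x z <= k + delta)%R \/ (gp y z <= k + delta)%R.
  move=> xy; have [h|h] := gp_hyp genS hypS x z y; [left|right]; rewrite 1?(gpC genS y); lra.
pose A x := (gp x g <= c + 2 * delta + delta)%R.
pose B x := (gp (g^-1 * x) g^-1 <= c + 2 * delta + delta)%R.
(* The two products add up to [len g], hence twice the bound c + 3 delta. *)
have AB x : A x -> B x -> (len g <= 2 * c + 6 * delta)%R.
  have e : len ((g^-1 * x)^-1 * g^-1) = len x by rewrite !grpE (lenV genS).
  by rewrite /A /B /gp e (lenV genS) (distC genS x g); lra.
have A01 : A x0 \/ A x1 by apply: one; lra.
have A02 : A x0 \/ A x2 by apply: one; lra.
have A12 : A x1 \/ A x2 by apply: one; lra.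
have B01 : B x0 \/ B x1 by apply/one/push.
have B02 : B x0 \/ B x2 by apply/one/push.
have B12 : B x1 \/ B x2 by apply/one/push.
(* Each of A and B fails for no more than one of the three points, so some point satisfies both. *)
have : (A x0 /\ B x0) \/ (A x1 /\ B x1) \/ (A x2 /\ B x2) by tauto.
by case=> [|[|]] [Ax Bx]; apply: AB Ax Bx.
Qed.

(** By normality N would fix the endpoints of three translates of r as well, and [tripod_bounded]
    would bound the lengths of its elements. *)
Lemma normal_no_fixed_ray (N : set G) r : ~ elementary G -> infinite_set N ->
  (forall g x, N x -> N (g * x * g^-1)) -> geodesic_ray S r -> ~ N `<=` stab r.
Proof.
move=> nel infN nN gr Nst; have [f fP] := orbit_infinite 3 nel gr.
have [c c0 cP] := translates_gp_bounded gr fP.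
have st i x : N x -> stab (fun p => f i * r p) x.
  move=> /(nN (f i)^-1)/Nst/(asymptotic_translate (f i))/asymptoticP[k hk].
  by apply/asymptoticP; exists k => p; have := hk p; rewrite !grpE.
have [x Nx] := infinite_len finS genS (2 * c + 6 * delta)%R infN.
apply/negP; rewrite -leNgt.
apply: (tripod_bounded (translate_ray (f 0%N) gr) (translate_ray (f 1%N) gr)
  (translate_ray (f 2%N) gr)); try (by apply: st); by move=> p q; apply: cP.
Qed.

(** Otherwise there are pairs (x_n, y_n) such that w y_n follows x_n up to n for all w in C of
    length up to n. The y_n accumulate along a ray r; as y_n and w y_n both follow x_n, each w in C
    fixes the endpoint of r. *)
Lemma uniform_diverging_set (C : set G) : subgroup C ->
  (forall r, geodesic_ray S r -> ~ C `<=` stab r) ->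
  exists W : seq G, (forall w, w \in W -> C w) /\
    exists c : rat, forall x y, exists2 w, w \in W & (gp x (w * y) <= c)%R.
Proof.
move=> sC nofix; apply: contrapT => no.
have /choice[xy xyP] : forall n : nat, exists xy : G * G,
    forall w, C w -> (len w <= n%:R)%R -> (n%:R < gp xy.1 (w * xy.2))%R.
  move=> n; have [l lP] := finite_len_ball finS genS (n%:R)%R.
  apply: contrapT => no'; apply: no; exists [seq w <- l | `[< C w >]]; split.
    by move=> w; rewrite mem_filter => /andP[/asboolP].
  exists (n%:R)%R => x y; apply: contrapT => no; apply: no'; exists (x, y) => w Cw wn /=.
  rewrite ltNge; apply/negP => h; apply: no; exists w => //.
  by rewrite mem_filter lP // andbT; apply/asboolP.
have y_large n : (n%:R < gp (xy n).1 (xy n).2)%R.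
  by have := xyP n 1 (subgroup1 sC); rewrite (len1 genS) mul1g; apply; apply: ler0n.
have [|r [gr lr rP]] := exists_limit_ray finS genS (x := fun n => (xy n).2).
  move=> c; have [N cN] := rat_le_nat c; exists N => n; rewrite -(ler_nat rat) => Nn.
  by have := y_large n; have := gp_ler genS (xy n).1 (xy n).2; lra.
apply: (nofix r gr) => w Cw; apply/asymptoticP; exists (3 * len w + 6 * delta)%R => p.
have [m hm] := rat_le_nat (len w + p%:R)%R.
have [n] := rP p m; rewrite -(ler_nat rat) => mn yn.
have h1 := gp_prefix_eq yn; rewrite lr in h1.
have h2 := gp_mul genS w (r p) (xy n).2.
have h3 : (n%:R < gp (xy n).1 (w * (xy n).2))%R.
  by apply: xyP => //; have := ler0n rat p; lra.
have h4 := y_large n; rewrite (gpC genS) in h4.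
have D0 := delta0; have w0 := len_ge0 S w.
have h5 := lenM genS w (r p); rewrite lr in h5.
rewrite (distC genS) distE lr.
have [k1|k1] := gp_hyp genS hypS (r p) (xy n).2 (w * r p); first lra.
rewrite (gpC genS (w * r p)) in h2.
have [k2|k2] := gp_hyp genS hypS (xy n).2 (xy n).1 (w * r p); first lra.
have [k3|k3] := gp_hyp genS hypS (xy n).1 (w * (xy n).2) (w * r p); first lra.
lra.
Qed.

End Boundary.

(** * The combination argument contradicting engulfing *)

Section Combination.
Variables (G : groupType) (S : set G).
Hypotheses (finS : finite_set S) (genS : generated S = [set: G]).
Variable delta : rat.
Hypotheses (delta0 : (0 <= delta)%R)
  (hypS : forall w x y z, (Num.min (gromov_product S w x y) (gromov_product S w y z)
     - delta <= gromov_product S w x z)%R)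
  (engG : forall K : set G, subgroup K -> finitely_generated K ->
            limit_set S K `<` boundary S -> engulfed K).
Local Notation len := (len S).
Local Notation gp := (gp S).
Local Notation stab := (stab S).
Implicit Types (x y z g h u w t : G) (r s : nat -> G).

(** The endpoint of r is missed: convergence to it would make the products with r exceed c + 1. *)
Lemma proper_limit_set (K : set G) r (c : rat) : geodesic_ray S r ->
  (forall p x, K x -> (gp (r p) x <= c)%R) -> limit_set S K `<` boundary S.
Proof.
move=> gr rK; split=> [xi []//|/(_ (ray_class S r))[]]; first by exists r.
have rr : ray_class S r r by split=> //; exact: (asymptotic_refl genS).
move=> _ [u uK /(_ r rr (c + 1)%R)[n /(_ n n (leqnn _) (leqnn _))]].
rewrite (gromov_product1 genS) (gpC genS); have := rK n (u n) (uK n); lra.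
Qed.

Variable gens : seq G.
Hypothesis gensE : S = [set` gens].
Local Notation n := (size gens).

(* For each generator s of G, the element t w s t'^-1, with t, t' in the closure C of H
   far along two of the rays and w in C chosen to avoid cancellation, plays ping-pong with P;
   a finite index subgroup containing H contains C, hence contains it only if it contains s. *)
Lemma combination (H P N : set G) (c d : rat) (rho : nat -> nat -> G) :
  (0 <= c)%R -> (0 <= d)%R -> finitely_generated H -> subgroup P -> H `<=` P ->
  N `<=` P -> (forall g x, N x -> N (g * x * g^-1)) ->
  (forall x, N x -> (len x <= d)%R) ->
  (forall a, P a -> ~ N a -> (2 * (c + 2 * delta) + delta < len a)%R) ->
  (forall j, (j <= n.*2)%N -> geodesic_ray S (rho j)) ->
  (forall i j p q, (i <= n.*2)%N -> (j <= n.*2)%N -> i != j ->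
    (gp (rho i p) (rho j q) <= c)%R) ->
  (forall j p a, (j <= n.*2)%N -> P a -> (gp (rho j p) a <= c)%R) ->
  (forall j (k : rat), (j <= n.*2)%N ->
    exists x p, profinite_closure H x /\ (k <= gp x (rho j p))%R) ->
  (forall r, geodesic_ray S r -> ~ profinite_closure H `<=` stab r) -> False.
Proof.
move=> c0 d0 [F finF EF] sP HP NP nN Nd Plong gr rr rP rC nofix.
set C := profinite_closure H in rC nofix.
have D0 := delta0.
have [W [WC [c2 divW]]] :=
  uniform_diverging_set finS genS delta0 hypS (subgroup_closure H) nofix.
have [lW lW0 lWP] := seq_bound W len.
have [lg lg0 lgP] := seq_bound gens len.
have c20 : (0 <= c2)%R.
  by have [w _] := divW 1 1; have := gp_ge0 genS 1 (w * 1); lra.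
pose c3 := (c2 + lW + lg)%R.
(* The loss c3 + delta of [u_rho], plus the threshold [Tlong] of ping-pong for the constant c + 2
   delta, plus 1 for strictness. *)
pose big := (c3 + delta + 4 * (c + 2 * delta) + 2 * d + 5 * delta + 1)%R.
have /choice[t tP] : forall j, exists x : G, (j <= n.*2)%N ->
    C x /\ exists p, (big <= gp x (rho j p))%R.
  move=> j; have [/(rC _ big)[x [p [Cx xp]]]|_] := boolP (j <= n.*2)%N; last by exists 1.
  by exists x => _; split=> //; exists p.
pose sg i : G := nth 1 gens i.
have /choice[w wP] : forall i : nat, exists w : G, w \in W /\
    (gp (t i.*2)^-1 (w * (sg i * (t i.*2.+1)^-1)) <= c2)%R.
  by move=> i; have [w wW h] := divW (t i.*2)^-1 (sg i * (t i.*2.+1)^-1); exists w.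
pose k i := t i.*2 * (w i * (sg i * (t i.*2.+1)^-1)).
(* Even indices stand for the k i and odd ones for their inverses, so that u j sets out along t j,
   hence along the ray rho j. *)
pose u j := if odd j then (k j./2)^-1 else k j./2.
have gens_lt j : (j < n.*2)%N -> (j./2 < n)%N by move=> ?; lia.
have u_t j : (j < n.*2)%N -> (len (t j) - c3 <= gp (u j) (t j))%R.
  move=> jn; have in_ := gens_lt j jn; have [wW hw] := wP j./2.
  have lw := lWP _ wW; have ls : (len (sg j./2) <= lg)%R by apply/lgP/mem_nth.
  have lw0 := len_ge0 S (w j./2); have ls0 := len_ge0 S (sg j./2).
  rewrite (gpC genS) /u; case: ifPn => oj.
    have ej : j = j./2.*2.+1 by rewrite -{1}(odd_double_half j) oj.
    (* For the inverse, the product controlled by the choice of w is translated by v, which costs up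
       to lW + lg. *)
    pose v := w j./2 * sg j./2; pose y := v^-1 * (t j./2.*2)^-1.
    have -> : (k j./2)^-1 = t j * y by rewrite /y /v /k -ej !grpE.
    rewrite (gp_step genS).
    have := gp_mul genS v (t j)^-1 y.
    have -> : v * y = (t j./2.*2)^-1 by rewrite /y mulVKg.
    have -> : v * (t j)^-1 = w j./2 * (sg j./2 * (t j./2.*2.+1)^-1).
      by rewrite /v -ej mulgA.
    rewrite (gpC genS) in hw.
    have := lenM genS (w j./2) (sg j./2); rewrite -/v /c3.
    by move: lw0 ls0 lw ls hw; lra.
  have ej : j = j./2.*2 by rewrite -{1}(odd_double_half j) (negbTE oj).
  rewrite /k -ej (gp_step genS); rewrite -ej in hw; rewrite /c3; lra.
have u_rho j : (j < n.*2)%N -> exists p, (big - c3 - delta <= gp (u j) (rho j p))%R.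
  move=> jn; have [_ [p tp]] := tP j (ltnW jn); exists p.
  have h1 := u_t j jn; have h2 := gp_lel genS (t j) (rho j p).
  have [h|h] := gp_hyp genS hypS (u j) (t j) (rho j p); rewrite /big /c3 in h1 tp *; lra.
have u_far j z : (j < n.*2)%N -> (forall p, (gp (rho j p) z <= c)%R) ->
    (gp (u j) z <= c + delta)%R.
  move=> jn zc; have [p hp] := u_rho j jn; apply: (gp_follow genS hypS (zc p)).
  by rewrite (gpC genS); rewrite /big in hp; lra.
pose T := [seq u j | j <- iota 0 n.*2].
have TP x : x \in T -> exists2 j, (j < n.*2)%N & x = u j.
  by move=> /mapP[j]; rewrite mem_iota => jn ->; exists j.
have Tu j : (j < n.*2)%N -> u j \in T by move=> jn; apply: map_f; rewrite mem_iota.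
(* The constant is c + 2 delta because bounding the product of u i and u j replaces two rays by
   elements, at delta each. *)
have pp := @ping_pong G S genS delta delta0 hypS P N T (c + 2 * delta)%R d sP NP nN.
pose K := generated (F `|` [set` T]).
have sK : subgroup K := subgroup_generated _.
have FP : F `<=` P.
  by apply: subset_trans HP; rewrite EF; apply: sub_generated.
have KK : K `<=` generated (P `|` [set` T]).
  apply: generated_sub; first exact: subgroup_generated.
  by move=> x [Fx|Tx]; apply: sub_generated; [left; apply: FP | right].
have [||L [sL LT fiL KL]] := engG sK.
- exists (F `|` [set` T]) => //; rewrite finite_setU; split=> //; exact: finite_seq.
(* The last ray, of index [n.*2], is followed by no u j: its endpoint is the one that the limit set
   of K misses. *)
- apply: (@proper_limit_set _ (rho n.*2) (c + 2 * delta + d + 2 * delta)%R).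
    exact: gr.
  move=> p x /KK; apply: pp; rewrite ?d0 //.
  + move=> _ /TP[j jn ->]; rewrite {1}/u; case: ifPn => oj.
      have -> : (k j./2)^-1^-1 = u j./2.*2 by rewrite invgK /u odd_double doubleK.
      by apply: Tu; lia.
    have -> : (k j./2)^-1 = u j./2.*2.+1.
      by rewrite /u /= odd_double /= uphalf_double.
    by apply: Tu; lia.
  + lra.
  + by move=> _ a /TP[j jn ->] Pa; have := u_far j a jn (fun p => rP j p a (ltnW jn) Pa); lra.
  + move=> _ _ /TP[i in_ ->] /TP[j jn ->] uij.
    have ij : i != j by apply: contraNneq uij => ->.
    have h q : (gp (rho j q) (u i) <= c + delta)%R.
      by rewrite (gpC genS); apply: u_far => // p'; apply: rr; rewrite // ltnW.
    have [q hq] := u_rho j jn; rewrite (gpC genS) in hq.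
    rewrite (gpC genS); apply: le_trans (gp_follow genS hypS (h q) _) _; last lra.
    by rewrite /big in hq; lra.
  + move=> _ /TP[j jn ->]; have [q hq] := u_rho j jn.
    by have := gp_lel genS (u j) (rho j q); rewrite /big in hq; lra.
  + by move=> a Pa; have := rP n.*2 p a (leqnn _) Pa; lra.
  + move=> _ /TP[j jn ->]; rewrite (gpC genS).
    have := u_far j (rho n.*2 p) jn; move=> h; apply: le_trans (h _) _; last lra.
    by move=> p'; apply: rr (ltnW jn) (leqnn _) (negbT (ltn_eqF jn)).
have cL : cofinite L by apply/cofiniteP.
have CL : C `<=` L.
  have HL : H `<=` L.
    by rewrite EF; apply: (generated_sub sL) => y Fy; apply: KL; apply: sub_generated; left.
  by move=> x /closureP; apply.
apply: LT.2 => x _; have : generated S x by rewrite genS.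
apply: (generated_sub sL) => y; rewrite gensE /= => yg.
have im : (index y gens < n)%N by rewrite index_mem.
set i := index y gens in im.
have Lk : L (k i).
  have -> : k i = u i.*2 by rewrite /u odd_double doubleK.
  by apply: KL; apply: sub_generated; right; apply: Tu; rewrite ltn_double.
have Lt j : (j <= n.*2)%N -> L (t j) by move=> /tP[/CL].
(* Solving the definition of k i for the generator y expresses it through elements of L. *)
have -> : y = (w i)^-1 * ((t i.*2)^-1 * k i) * t i.*2.+1.
  by rewrite /k !grpE /sg nth_index.
have Lw : L (w i) by have [wW _] := wP i; apply: CL; apply: WC.
apply: subgroupM => //; last by apply: Lt; lia.
apply: subgroupM => //; first exact: subgroupV.
by apply: subgroupM => //; apply: subgroupV => //; apply: Lt; lia.
Qed.

End Combination.

(** * Quasi-convex subgroups *)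

Section QuasiConvex.
Variables (G : groupType) (S : set G).
Hypotheses (finS : finite_set S) (genS : generated S = [set: G]).
Local Notation len := (len S).
Local Notation gp := (gp S).
Local Notation wl := (word_length S).
Implicit Types (x y z g h u w t a : G) (r s : nat -> G).

Lemma geodesic_exists x : exists p, [/\ geodesic_segment S (wl x) p, p 0%N = 1 & p (wl x) = x].
Proof.
have [[l [lS sl lx]] _] := word_lengthP genS x.
pose p i := \prod_(z <- take i l) z.
have px : p (wl x) = x by rewrite /p take_oversize ?sl.
have p0 : p 0%N = 1 by rewrite /p take0 big_nil.
have step i j : (i <= j)%N -> (j <= wl x)%N -> (wl ((p i)^-1 * p j) <= j - i)%N.
  move=> ij jx; have e : p j = p i * \prod_(z <- drop i (take j l)) z.
    by rewrite /p -(take_takel l ij) -big_cat cat_take_drop.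
  rewrite e mulKg; apply: (word_lengthP genS _).2; exists (drop i (take j l)); split=> //.
    by move=> z /mem_drop/mem_take/lS.
  by rewrite size_drop size_takel ?sl.
exists p; split=> // i j ij jx; apply/eqP; rewrite eqn_leq step //=.
have := step 0%N i isT (leq_trans ij jx); have := step j _ jx (leqnn _).
rewrite p0 px invg1 mul1g => h1 h2.
have := wlM genS (p i) ((p i)^-1 * p j); have := wlM genS (p j) ((p j)^-1 * x).
rewrite !mulVKg /word_dist; lia.
Qed.

(** Along a geodesic from 1 to x, each vertex has an element of K within D, the quasi-convexity
    constant plus the length of a coset representative. Consecutive choices differ by elements of K
    of length up to 2 D + 1. *)
Lemma quasi_convex_finitely_generated (H K : set G) Y : subgroup H -> subgroup K ->
  K `<=` H -> covers Y K H -> quasi_convex S H -> finitely_generated K.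
Proof.
move=> sH sK KH cov [C qc].
have [c [_ cY]] : exists c : rat, (0 <= c)%R /\ forall y, y \in Y -> (len y <= c)%R.
  by have [c c0 cY] := seq_bound Y len; exists c.
have [D DE] : exists D : rat, (D = C%:R + c)%R by exists (C%:R + c)%R.
have [l lP] := finite_len_ball finS genS (2 * D + 1)%R.
exists [set x | K x /\ (len x <= 2 * D + 1)%R].
  apply: (@sub_finite_set _ _ [set` l]); last exact: finite_seq.
  by move=> x [_ /lP].
set B := [set x | _]; apply/seteqP; split; last by apply: generated_sub => // x [].
move=> x Kx; have [p [geo p0 px]] := geodesic_exists x.
have near i : (i <= wl x)%N -> exists2 h, K h & (len ((p i)^-1 * h) <= D)%R.
  move=> ix; have [||h Hh hi] := qc _ p geo _ _ i ix.
  - by rewrite p0; apply: (subgroup1 sH).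
  - by rewrite px; apply: KH.
  have [y yY Ky] := cov _ (subgroupV sH Hh).
  exists (h * y); first by have := subgroupV sK Ky; rewrite invgM !invgK.
  rewrite mulgA DE; apply: le_trans (lenM genS _ _) _; apply: lerD; last exact: cY.
  by rewrite /len ler_nat.
have : forall i, (i <= wl x)%N -> forall h, K h -> (len ((p i)^-1 * h) <= D)%R ->
    generated B h.
  elim=> [_ h Kh|i IH ix h Kh hi].
    rewrite p0 invg1 mul1g => hD; apply: sub_generated; split=> //.
    by have := len_ge0 S h; lra.
  have [h' Kh' hi'] := near i (ltnW ix).
  have gh' := IH (ltnW ix) h' Kh' hi'.
  rewrite -[h](mulVKg h'); apply: (subgroupM (subgroup_generated _) gh').
  apply: sub_generated; split; first by apply: subgroupM => //; apply: subgroupV.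
  have h1 := dist_tri genS h' (p i) h; have h2 := dist_tri genS (p i) (p i.+1) h.
  have h3 : len ((p i)^-1 * p i.+1) = 1%R.
    by rewrite /len [word_length _ _](geo i i.+1) // subSnn.
  by rewrite (distC genS h' (p i)) in h1; lra.
move=> /(_ _ (leqnn _) x Kx); apply; rewrite px mulVg (len1 genS).
have [h _] := near 0%N (leq0n _).
by have := len_ge0 S ((p 0%N)^-1 * h); lra.
Qed.

Variable delta : rat.
Hypotheses (delta0 : (0 <= delta)%R)
  (hypS : forall w x y z, (Num.min (gromov_product S w x y) (gromov_product S w y z)
     - delta <= gromov_product S w x z)%R).

(** If x followed a geodesic from 1 to a for too long, some h in H would lie near that common part
    and h^-1 x would be shorter than x. The summand 1 pays for rounding the product down to a vertex
    index. *)
Lemma quasi_convex_orthogonal (H : set G) : subgroup H -> quasi_convex S H ->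
  exists2 c : rat, (0 <= c)%R & forall x, (forall a, H a -> (len x <= len (a * x))%R) ->
    forall a, H a -> (gp x a <= c)%R.
Proof.
move=> sH [C qc]; exists (C%:R + 2 * delta + 1)%R.
  by have := ler0n rat C; move: delta0; lra.
move=> x xmin a Ha; have [p [geo p0 pa]] := geodesic_exists a.
have /andP[] := truncn_itv (gp_ge0 genS x a).
set i := Num.truncn _ => i1 i2.
have ia : (i <= wl a)%N.
  by rewrite -(ler_nat rat); apply: le_trans i1 _; exact: gp_ler.
have [||h Hh hi] := qc _ p geo _ _ i ia.
- by rewrite p0; apply: (subgroup1 sH).
- by rewrite pa.
have {}hi : (len ((p i)^-1 * h) <= C%:R)%R by rewrite /len ler_nat.
have li : len (p i) = (i%:R)%R.
  by have := geo 0%N i isT ia; rewrite p0 /word_dist invg1 mul1g subn0 /len => ->.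
have lia : len a = (len (p i) + len ((p i)^-1 * a))%R.
  rewrite li -{2}pa /len [word_length _ (_ * _)](geo i (wl a)) //.
  by rewrite -natrD subnKC.
have h1 := gp_prefix_eq lia; have h2 := xmin h^-1 (subgroupV sH Hh).
have h3 := dist_tri genS h (p i) x; rewrite (distC genS h (p i)) in h3.
have h4 := distE S (p i) x; rewrite li in h1 h4.
rewrite -natr1 in i2; move: delta0 => D0.
have [k|k] := gp_hyp genS hypS (p i) a x; rewrite ?(gpC genS a) in k; lra.
Qed.

Lemma minimal_coset_representative (H : set G) x : subgroup H ->
  exists2 a, H a & forall b, H b -> (len (a * x) <= len (b * (a * x)))%R.
Proof.
move=> sH; have ex : exists n, `[< exists2 a, H a & wl (a * x) = n >].
  by exists (wl (1 * x)); apply/asboolP; exists 1 => //; apply: subgroup1.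
case: (ex_minnP ex) => n /asboolP[a Ha an] nmin; exists a => // b Hb.
rewrite /len ler_nat an; apply: nmin; apply/asboolP; exists (b * a).
  exact: subgroupM.
by rewrite mulgA.
Qed.

(** Each new element is chosen longer than all the previous ones by more than c. *)
Lemma separated_sequence (H : set G) n (c : rat) : infinite_set H ->
  exists f : nat -> G, (forall i, (i < n)%N -> H (f i)) /\
    forall i j, (i < j < n)%N -> (c < len ((f i)^-1 * f j))%R.
Proof.
move=> infH; elim: n => [|n [f [fH fc]]].
  by exists (fun=> 1); split=> // i j; rewrite andbF.
have [d d0 dP] := seq_bound [seq f i | i <- iota 0 n] len.
have [g Hg gl] := infinite_len finS genS (c + d)%R infH.
exists (fun i => if (i < n)%N then f i else g); split=> [i _|i j /andP[ij]].
  by case: ifP => // /fH.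
rewrite ltnS leq_eqVlt => /orP[/eqP jn|jn]; last first.
  by rewrite jn (ltn_trans ij jn); apply: fc; rewrite ij.
rewrite jn ltnn -jn ij; have h1 := lenM genS (f i) ((f i)^-1 * g).
have h2 : (len (f i) <= d)%R by apply: dP; apply: map_f; rewrite mem_iota -jn.
by rewrite mulVKg in h1; lra.
Qed.

End QuasiConvex.

(** * Closures of the trivial subgroup and of quasi-convex subgroups *)

Section Closures.
Variables (G : groupType) (S : set G).
Hypotheses (finS : finite_set S) (genS : generated S = [set: G]).
Variable delta : rat.
Hypotheses (delta0 : (0 <= delta)%R)
  (hypS : forall w x y z, (Num.min (gromov_product S w x y) (gromov_product S w y z)
     - delta <= gromov_product S w x z)%R)
  (nonelemG : ~ elementary G)
  (engG : forall K : set G, subgroup K -> finitely_generated K ->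
            limit_set S K `<` boundary S -> engulfed K).
Local Notation len := (len S).
Local Notation gp := (gp S).
Local Notation stab := (stab S).
Implicit Types (x y z g h u w t a : G) (r s : nat -> G).

Lemma limit_ray_of_set (A : set G) : (forall c : rat, exists2 x, A x & (c < len x)%R) ->
  exists r, [/\ geodesic_ray S r, forall p, len (r p) = (p%:R)%R &
    forall p, exists2 x, A x & len x = (len (r p) + len ((r p)^-1 * x))%R].
Proof.
move=> Aoo; have /choice[x xP] : forall n : nat, exists x, A x /\ (n%:R < len x)%R.
  by move=> n; have [x] := Aoo (n%:R)%R; exists x.
have [|r [gr lr rP]] := exists_limit_ray finS genS (x := x).
  move=> c; have [N cN] := rat_le_nat c; exists N => n; rewrite -(ler_nat rat) => Nn.
  by have [_ h] := xP n; lra.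
exists r; split=> // p; have [n _ h] := rP p 0%N.
by exists (x n) => //; have [] := xP n.
Qed.

Lemma gp_conj g x y z : (gp x z - 2 * len g <= gp (g * x * g^-1) (g * z))%R.
Proof.
have := gp_mulr genS (g * x) g^-1 (g * z); have := gp_mul genS g x z.
rewrite (lenV genS); lra.
Qed.

(** If cl 1 is infinite it has a limit ray r, and [combination] applies with H = P = N = 1 and
    translates of r with distinct endpoints. *)
Lemma closure1_finite : finite_set (profinite_closure [set 1 : G]).
Proof.
apply: contrapT => infN; have D0 := delta0.
have [r [gr lr rP]] := limit_ray_of_set (fun c => infinite_len finS genS c infN).
have [gens gensE] : exists l : seq G, S = [set` l] by apply/finite_seqP.
have [f fP] := orbit_infinite finS genS delta0 hypS (size gens).*2.+1 nonelemG gr.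
have [c c0 cP] := translates_gp_bounded genS delta0 hypS gr fP.
have s1 : subgroup [set 1 : G] by split=> // _ _ -> ->; rewrite /= mulgV.
apply: (@combination _ _ finS genS _ delta0 hypS engG gens gensE
  [set 1] [set 1] [set 1] c 0%R (fun j p => f j * r p)) => //.
- exists set0; first exact: finite_set0.
  apply/seteqP; split; last exact: generated_sub.
  by move=> _ ->; apply: (subgroup1 (subgroup_generated _)).
- by move=> g _ ->; rewrite /= mulg1 mulgV.
- by move=> _ ->; rewrite (len1 genS).
- by move=> j _; apply: translate_ray.
- by move=> j p _ _ ->; apply: le_trans (gp_ler genS _ _) _; rewrite (len1 genS).
(* Conjugation by f j preserves cl 1 and carries an element following r to one following f j * r, at
   a loss of twice the length of f j. *)
- move=> j k _; have [p pk] := rat_le_nat (k + 2 * len (f j))%R.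
  have [x Nx xp] := rP p; exists (f j * x * (f j)^-1), p.
  split; first exact: closure1_normal.
  have h1 := gp_conj (f j) x 1 (r p); have h2 := gp_prefix_eq xp.
  rewrite (gpC genS) lr in h2; lra.
- move=> s gs; apply: (normal_no_fixed_ray finS genS delta0 hypS nonelemG infN) => //.
  by move=> g x; apply: closure1_normal.
Qed.

Lemma quasi_convex_almost_separable (H : set G) : subgroup H -> quasi_convex S H ->
  almost_separable H.
Proof.
move=> sH qc; have D0 := delta0.
have sC := subgroup_closure H; have HC := @sub_closure G H.
set N := profinite_closure [set 1 : G]; have finN : finite_set N := closure1_finite.
have sN : subgroup N := subgroup_closure _.
have nN g x : N x -> N (g * x * g^-1) := @closure1_normal G g x.
(* For finite H, the closure is covered by finitely many cosets of cl 1, hence finite. *)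
have [finH|infH] := pselect (finite_set H).
  have [Y EY] : exists l : seq G, H = [set` l] by apply/finite_seqP.
  have s1 : subgroup [set 1 : G] by split=> // _ _ -> ->; rewrite /= mulgV.
  have cov : covers Y [set 1] H.
    by move=> x Hx; exists x; rewrite ?mulVg //; have : [set` Y] x by rewrite -EY.
  have H1 : [set 1] `<=` H by move=> _ ->; apply: subgroup1.
  have /finite_seqP[l El] := covers_finite (covers_closure s1 sH H1 cov) finN.
  apply: (@covers_finite_index _ l) => // x Cx; exists x; last by rewrite mulVg; apply: subgroup1.
  by have : [set` l] x by rewrite -El.
apply: contrapT => nfi.
have {nfi}nfi Y : ~ covers Y H (profinite_closure H).
  by move=> cov; apply: nfi; apply: covers_finite_index cov.
have [kappa k0 kP] := quasi_convex_orthogonal genS delta0 hypS sH qc.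
pose X := [set x | profinite_closure H x /\
  forall a, H a -> (len x <= len (a * x))%R].
(* X is unbounded: otherwise the inverses of its finitely many elements would represent all left
   cosets of H in cl H. *)
have [c|r [gr lr rX]] := @limit_ray_of_set X.
  apply: contrapT => no; have [l lP] := finite_len_ball finS genS c.
  apply: (nfi [seq x^-1 | x <- l]) => y Cy.
  have [a Ha amin] := minimal_coset_representative S y^-1 sH.
  exists (a * y^-1)^-1; last by rewrite invgK mulgVK.
  apply/mapP; exists (a * y^-1) => //; apply: lP; rewrite leNgt; apply/negP => h; apply: no.
  exists (a * y^-1) => //; split=> //.
  by apply: (subgroupM sC); [apply: HC|apply: (subgroupV sC)].
have rH p a : H a -> (gp (r p) a <= kappa)%R.
  move=> Ha; have [x [Cx xmin] xp] := rX p.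
  by apply: le_trans (gp_prefix genS a xp) _; apply: kP.
have [gens gensE] : exists l : seq G, S = [set` l] by apply/finite_seqP.
set n := size gens.
(* The separation 2 kappa + delta is what [gp_turn] needs to make distinct translates f j * r
   diverge. *)
have [f [fH fsep]] := separated_sequence finS genS n.*2.+1 (2 * kappa + delta)%R infH.
have [b b0 bP] := seq_bound [seq f j | j <- iota 0 n.*2.+1] len.
have fb j : (j <= n.*2)%N -> (len (f j) <= b)%R.
  by move=> jn; apply/bP/map_f; rewrite mem_iota.
have rr' i j p q : (i <= n.*2)%N -> (j <= n.*2)%N -> (i < j)%N ->
    (gp (f i * r p) (f j * r q) <= b + kappa + delta)%R.
  move=> iN jN ij; have sep := fsep i j; rewrite ij ltnS jN in sep.
  have Ha : H ((f i)^-1 * f j).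
    by apply: subgroupM => //; [apply: subgroupV => //|]; apply: fH; rewrite ltnS.
  have h2 : (gp ((f i)^-1 * f j)^-1 (r q) <= kappa)%R.
    by rewrite (gpC genS); apply: rH; apply: subgroupV.
  have h1 := gp_turn genS hypS (rH p _ Ha) h2 (sep isT).
  have h3 := gp_mulV genS (f i) (r p) ((f i)^-1 * f j * r q).
  have e : f i * ((f i)^-1 * f j * r q) = f j * r q by rewrite -mulgA mulVKg.
  rewrite e in h3; have h4 := fb i iN; lra.
have rr i j p q : (i <= n.*2)%N -> (j <= n.*2)%N -> i != j ->
    (gp (f i * r p) (f j * r q) <= b + kappa + delta)%R.
  move=> iN jN; rewrite neq_ltn => /orP[|] ij; first exact: rr'.
  by rewrite (gpC genS); apply: rr'.
have rrH j p a : (j <= n.*2)%N -> H a -> (gp (f j * r p) a <= b + kappa)%R.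
  move=> jN Ha; have h1 := gp_mulV genS (f j) (r p) ((f j)^-1 * a).
  have h2 : (gp (r p) ((f j)^-1 * a) <= kappa)%R.
    by apply: rH; apply: subgroupM => //; apply: subgroupV => //; apply: fH.
  by rewrite mulVKg in h1; have := fb j jN; lra.
have [d d0 Nd] : exists2 d : rat, (0 <= d)%R & forall x, N x -> (len x <= d)%R.
  have /finite_seqP[l El] := finN; have [d d0 dP] := seq_bound l len.
  by exists d => // x; rewrite El => /dP.
(* The summand d, in c and again in R, pays for the factor m in N of an element h * m of P. *)
pose c := (b + kappa + delta + d)%R.
pose R := (2 * (c + 2 * delta) + delta + d)%R.
(* Residual finiteness modulo N: the ball of radius R has finitely many elements outside N = cl 1,
   and one L excludes them all. *)
have [L [[sL [Y cY]] _ LR]] : exists L, [/\ cofinite L, [set 1] `<=` L &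
    forall x, L x -> (len x <= R)%R -> N x].
  have [l lP] := finite_len_ball finS genS R.
  have [|L [cL L1 Ll]] := @cofinite_avoid _ [set 1] [seq x <- l | ~~ `[< N x >]].
    by move=> x; rewrite mem_filter => /andP[/asboolP].
  exists L; split=> // x Lx xR; apply: contrapT => nNx.
  by apply: (Ll x) => //; rewrite mem_filter lP // andbT; apply/asboolP.
have [Y' _ cY'] := covers_restrict sL sH (fun _ _ => I) cY.
set H' := H `&` L in cY'.
have sH' : subgroup H' by apply: subgroupI.
have HH : H' `<=` H by move=> x [].
have cC := covers_closure sH' sH HH cY'.
have sC' := subgroup_closure H'.
pose P := [set x | exists h m, [/\ H' h, N m & x = h * m]].
apply: (@combination _ _ finS genS _ delta0 hypS engG gens gensE
  H' P N c d (fun j p => f j * r p)) => //.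
- by rewrite /c; lra.
- exact: (quasi_convex_finitely_generated finS genS sH sH' HH cY' qc).
- split; first by exists 1, 1; rewrite mulg1; split=> //; apply: subgroup1.
  move=> _ _ [h [m [H'h Nm ->]]] [h' [m' [H'h' Nm' ->]]].
  exists (h / h'), (h' * (m / m') * h'^-1); split; last by rewrite !grpE.
    exact: sH'.2.
  by apply: nN; apply: sN.2.
- by move=> h H'h; exists h, 1; rewrite mulg1; split=> //; apply: subgroup1.
- by move=> m Nm; exists 1, m; rewrite mul1g; split=> //; apply: subgroup1.
- move=> _ [h [m [[Hh Lh] Nm ->]]] nNhm.
  have h1 := Nd _ Nm; have h2 := lenMr genS h m.
  have : (R < len h)%R.
    rewrite ltNge; apply/negP => /(LR _ Lh) Nh; apply: nNhm; exact: (subgroupM sN).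
  by rewrite /R; lra.
- by move=> j _; apply: translate_ray.
- by move=> i j p q iN jN ij; have := rr i j p q iN jN ij; rewrite /c; lra.
- move=> j p _ jN [h [m [[Hh _] Nm ->]]].
  have h1 := rrH j p h jN Hh; have h2 := gp_mulr_le genS h m (f j * r p).
  rewrite !(gpC genS _ (f j * r p)) in h2; have := Nd _ Nm; rewrite /c; lra.
- move=> j k jN; have [y0 y00 yP] := seq_bound Y' len.
  have [p pk] := rat_le_nat (k + b + y0)%R.
  have [x [Cx _] xp] := rX p.
  (* Inverting puts the coset representative on the right: f j * x * y lies in cl H' with y in Y',
     and it follows f j * r up to a bounded loss. *)
  have Cfx : profinite_closure H (f j * x)^-1.
    by apply: (subgroupV sC); apply: (subgroupM sC) => //; apply: HC; apply: fH.
  have [y yY C'y] := cC _ Cfx; exists (f j * x * y), p; split.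
    by have := subgroupV sC' C'y; rewrite invgM !invgK.
  have h1 := gp_mulr genS (f j * x) y (f j * r p); have h2 := gp_mul genS (f j) x (r p).
  have h3 := gp_prefix_eq xp; rewrite (gpC genS) lr in h3.
  have := fb j jN; have := yP y yY; lra.
(* If cl H' fixed the endpoint of s, some z in H' would generate a finite index subgroup of that
   stabilizer. Finitely many cosets of H would then cover cl H', hence cl H. *)
- move=> s gs Cs; have infH' : infinite_set H'.
    by move=> finH'; apply: infH; apply: covers_finite cY' finH'.
  have [z [H'z _ [F cF]]] := stab_cyclic finS genS delta0 hypS gs sH' infH'
    (subset_trans (@sub_closure _ H') Cs).
  have zH : generated [set z] `<=` H.
    by apply: (generated_sub sH) => _ ->; apply: HH.
  apply: (nfi [seq y * x | y <- Y', x <- F]).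
  apply: covers_trans cC _ => x /Cs/cF[y yF zy]; exists y => //; exact: zH.
Qed.

End Closures.

Theorem theorem5p2 (G : groupType) (S : set G)
  (finS : finite_set S) (genS : generated S = [set: G])
  (hypG : hyperbolic S) (nonelemG : ~ elementary G)
  (engG : forall K : set G, subgroup K -> finitely_generated K ->
            limit_set S K `<` boundary S -> engulfed K) :
  forall H : set G, subgroup H -> quasi_convex S H -> almost_separable H.
Proof.
have [delta delta0 hypS] := hypG => H.
exact: (quasi_convex_almost_separable finS genS delta0 hypS nonelemG engG).
Qed.
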